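(* For any homogenized spectral pencil $T_\lambda=\sum_{i=0}^k Q_i(z)\lambda^{k-i}\frac{d^i}{dz^i}$ of general type, all the roots of all its polynomial eigenfunctions $p_{n,j}(z)$ ($j=1,\dots,k$, $n$ sufficiently large) lie in a certain disk in $\mathbb{C}$ centered at the origin (one disk for all $n$ and $j$).
   Context: A homogenized spectral pencil is a family $T_\lambda=\sum_{i=0}^k Q_i(z)\lambda^{k-i}\frac{d^i}{dz^i}$, $\lambda\in\mathbb{C}$, where each $Q_i(z)=\sum_{j=0}^i a_{i,j}z^j$ is a complex polynomial of degree at most $i$. Its characteristic equation is $a_{k,k}+a_{k-1,k-1}t+\dots+a_{0,0}t^k=0$. The pencil is of general type if (i) $\deg Q_k=k$ (i.e. $a_{k,k}\neq0$), and (ii) no two roots of the characteristic equation lie on a line through the origin (in particular, $0$ is not a root). It is understood that the characteristic equation has $k$ distinct roots $\alpha_1,\dots,\alpha_k$ (so $a_{0,0}\neq 0$). An eigenvalue is a value of $\lambda$ for which $T_\lambda p=0$ has a nonzero polynomial solution $p$ (an eigenpolynomial, or polynomial eigenfunction). For a homogenized spectral pencil $T_\lambda=\sum_{i=0}^k Q_i(z)\lambda^{k-i}\frac{d^i}{dz^i}$ of general type whose characteristic equation has $k$ distinct roots $\alpha_1,\dots,\alpha_k$, for all sufficiently large $n$ there are exactly $k$ distinct eigenvalues $\lambda_{n,1},\dots,\lambda_{n,k}$ for which there is an eigenpolynomial of degree exactly $n$, labeled so that $\lim_{n\to\infty}\lambda_{n,j}/n=\alpha_j$; $p_{n,j}(z)$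 denotes a polynomial of degree exactly $n$ with $T_{\lambda_{n,j}}p_{n,j}=0$. *)

(* Defs.v *)
(* MathComp / MathComp-Analysis world; the complex numbers are R[i], R : realType *)
From HB Require Import structures.
From mathcomp Require Import all_boot all_order all_algebra.
From mathcomp Require Import all_classical all_reals all_analysis.
From mathcomp Require Import complex.

Set Implicit Arguments.
Unset Strict Implicit.
Unset Printing Implicit Defensive.

Import Order.TTheory GRing.Theory Num.Theory.
Import numFieldNormedType.Exports.

Local Open Scope classical_set_scope.
Local Open Scope ring_scope.
Local Open Scope complex_scope.

(* The coefficient a_{i,j} is (Q i)`_j. *)
Definition pencil_coefs (R : realType) (k : nat) (Q : 'I_k.+1 -> {poly R[i]}) :
  Prop := forall i : 'I_k.+1, (size (Q i) <= i.+1)%N.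

Definition pencil (R : realType) (k : nat) (Q : 'I_k.+1 -> {poly R[i]})
    (lambda : R[i]) (p : {poly R[i]}) : {poly R[i]} :=
  \sum_(i < k.+1) lambda ^+ (k - i) *: (Q i * p^`(i)).

Definition char_poly_pencil (R : realType) (k : nat)
    (Q : 'I_k.+1 -> {poly R[i]}) : {poly R[i]} :=
  \sum_(i < k.+1) (Q i)`_i *: 'X^(k - i).

(* A line through the origin is the real span of a nonzero complex number. *)
Definition on_line_through_origin (R : realType) (v z : R[i]) : Prop :=
  exists t : R, z = t%:C * v.

(* deg Q_k = k means a_{k,k} != 0, so that 0 is not a root of the
   characteristic polynomial; it is not a consequence of the second clause
   when there is only one root. *)
Definition general_type (R : realType) (k : nat)
    (Q : 'I_k.+1 -> {poly R[i]}) : Prop :=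
  size (Q ord_max) = k.+1 /\
  (forall x y : R[i],
     root (char_poly_pencil Q) x -> root (char_poly_pencil Q) y -> x != y ->
     ~ exists2 v : R[i], v != 0 &
         on_line_through_origin v x /\ on_line_through_origin v y).

Definition enumerates_char_roots (R : realType) (k : nat)
    (Q : 'I_k.+1 -> {poly R[i]}) (alpha : 'I_k -> R[i]) : Prop :=
  injective alpha /\ forall j : 'I_k, root (char_poly_pencil Q) (alpha j).

Definition eigenpolynomial (R : realType) (k : nat)
    (Q : 'I_k.+1 -> {poly R[i]}) (lambda : R[i]) (p : {poly R[i]}) : Prop :=
  p != 0 /\ pencil Q lambda p = 0.

(* Degree exactly n is size n.+1. *)
Definition eigenpolynomial_deg (R : realType) (k : nat)
    (Q : 'I_k.+1 -> {poly R[i]}) (n : nat) (lambda : R[i]) (p : {poly R[i]}) :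
  Prop := eigenpolynomial Q lambda p /\ size p = n.+1.

(* The values lambda n j are unconstrained for the finitely many n below the
   threshold.  R[i]^o only serves to give R[i] its norm topology. *)
Definition eigenvalue_labelling (R : realType) (k : nat)
    (Q : 'I_k.+1 -> {poly R[i]}) (alpha : 'I_k -> R[i])
    (lambda : nat -> 'I_k -> R[i]) : Prop :=
  (exists N : nat, forall n : nat, (N <= n)%N ->
     injective (lambda n) /\
     forall mu : R[i],
       (exists p : {poly R[i]}, eigenpolynomial_deg Q n mu p) <->
       (exists j : 'I_k, mu = lambda n j)) /\
  (forall j : 'I_k,
     (fun n : nat => lambda n j / n%:R : R[i]^o) @ \oo --> (alpha j : R[i]^o)).

(* Main.v *)
Require Import Defs.
From HB Require Import structures.
From mathcomp Require Import all_boot all_order all_algebra.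
From mathcomp Require Import all_classical all_reals all_analysis.
From mathcomp Require Import complex.
From mathcomp Require Import ring lra zify.
Import Order.TTheory GRing.Theory Num.Theory.
Local Open Scope ring_scope.
Local Open Scope complex_scope.

(** Let [p] be an eigenpolynomial of degree [n] with eigenvalue [lambda], and
    put [e = 1/n], [v = n/lambda] and [x = 1/z].  The coefficients of [p]
    say little about its roots (those of [(z - 1)^n] grow exponentially); the
    logarithmic derivative is the right unknown.  As a power series in [x],
    [z p'(z) / (n p(z)) = w(x) = sum_r w_r x^r], where [n w_r] is the [r]-th
    power sum of the roots of [p].  So the roots lie in the disk of radius [M]
    as soon as [|w_r| <= M^r] for all [r]: this is [psum_bound_roots].

    The equation [T_lambda p = 0] divided by [p] is a Riccati equation for [w]
    ([riccati_pencil]), and its coefficient of [x^r] reads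
    [H_r w_r = (terms in the w_s with s < r)].  If [D m] denotes the coefficient
    of [z^m] in [lambda^-k T_lambda z^m], which is a polynomial in [m], then
    [H_r] is [n] times the divided difference of [D] between [n - r] and [n].
    The crucial estimate [nonresonance] is
    [|H_r| >= c (1 + r/n)^(k-1)], uniformly in [r >= 1] and in large [n].  In
    the limit of large [n], with [r/n] replaced by a real number [s > 0], one
    has [v = beta_j], where the [beta_i] are the inverses of the characteristic
    roots, and [H] is up to a constant the product over [i <> j] of the factors
    [(1 - s) beta_j - beta_i].  Since the [beta_i] lie on different lines
    through the origin, each of these is at least a multiple of [1 + s], even
    when [1 - s] is negative, and that happens for all [r > n].

    Differentiating the [r]-th term of a series multiplies it by [r], so the
    remaining terms of the Riccati equation are also allowed to grow like
    [(1 + r/n)^(k-1)]; this is exactly compensated by [H_r].  Hence the sequence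
    [|w_r|] satisfies the inequalities of an algebraic equation with bounded
    coefficients, and a majorant argument gives a radius [M] independent of [n]
    ([riccati_majorant]).

    The eigenvalues are found from the triangular action of [T_lambda] on
    monomials.  The diagonal entry at [z^n], for [lambda = n t], is [n^k] times
    a polynomial in [t] that converges to the characteristic polynomial, so its
    roots can be labelled by the characteristic roots ([root_labelling]).  An
    eigenpolynomial of degree exactly [n] exists because the diagonal entries
    at [z^m], [m < n], do not vanish; up to nonzero factors they are the numbers
    [H_(n-m)], so that this is the same nonresonance estimate. *)

Set Implicit Arguments.
Unset Strict Implicit.
Unset Printing Implicit Defensive.

(** * The modulus as a real number *)

(** The norm [`|z|] is an element of the partially ordered field [R[i]]; with
    real values, the estimates take place in a totally ordered field. *)
Definition nm (R : realType) (z : R[i]) : R := ComplexField.Normc.normc z.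
Arguments nm {R} z : simpl never.

Section Modulus.
Variable R : realType.
Implicit Types z w : R[i].

Lemma nmE z : `|z| = (nm z)%:C.
Proof. by case: z. Qed.

Lemma nm_ge0 z : 0 <= nm z.
Proof. by rewrite -lecR -nmE normr_ge0. Qed.

Lemma nm0 : nm (0 : R[i]) = 0. Proof. exact: ComplexField.Normc.normc0. Qed.
Lemma nm1 : nm (1 : R[i]) = 1. Proof. exact: ComplexField.Normc.normc1. Qed.

Lemma nmM z w : nm (z * w) = nm z * nm w.
Proof. exact: ComplexField.Normc.normcM. Qed.

Lemma nmV z : nm z^-1 = (nm z)^-1.
Proof. exact: ComplexField.Normc.normcV. Qed.

Lemma nmD z w : nm (z + w) <= nm z + nm w.
Proof. exact: le_normcD. Qed.

Lemma nmN z : nm (- z) = nm z.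
Proof. exact: normcN. Qed.

Lemma nmB z w : nm (z - w) <= nm z + nm w.
Proof. by rewrite -(nmN w) nmD. Qed.

Lemma nm_eq0 z : (nm z == 0) = (z == 0).
Proof.
by apply/eqP/eqP => [/ComplexField.Normc.eq0_normc //|->]; exact: nm0.
Qed.

Lemma nm_gt0 z : (0 < nm z) = (z != 0).
Proof. by rewrite lt_def nm_eq0 nm_ge0 andbT. Qed.

Lemma nmX z n : nm (z ^+ n) = nm z ^+ n.
Proof. by elim: n => [|n IH]; rewrite ?nm1 // !exprS nmM IH. Qed.

Lemma nm_nat n : nm (n%:R : R[i]) = n%:R.
Proof. by rewrite /nm normcMn ComplexField.Normc.normc1. Qed.

Lemma nm_real (x : R) : nm x%:C = `|x|.
Proof. by rewrite /nm /= expr0n /= addr0 sqrtr_sqr. Qed.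

Lemma nm_sum (I : Type) (s : seq I) (P : pred I) (F : I -> R[i]) :
  nm (\sum_(i <- s | P i) F i) <= \sum_(i <- s | P i) nm (F i).
Proof.
elim/big_rec2: _ => [|i x z _ H]; first by rewrite nm0.
by rewrite (le_trans (nmD _ _)) // lerD2l.
Qed.

Lemma nm_prod (I : Type) (s : seq I) (P : pred I) (F : I -> R[i]) :
  nm (\prod_(i <- s | P i) F i) = \prod_(i <- s | P i) nm (F i).
Proof.
by elim/big_rec2: _ => [|i x z _ H]; rewrite ?nm1 // nmM H.
Qed.

End Modulus.

(** * Scaled falling factorials and their divided differences *)

Section FallingFactorial.
Variable F : comNzRingType.
Implicit Types (e t : F) (i r : nat).

(** With [e = 1/n] this is [n (n - 1) ... (n - i + 1) / n^i]; at [e = 0] it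
    is [1]. *)
Fixpoint sffact e i : F :=
  if i is i'.+1 then (1 - i'%:R * e) * sffact e i' else 1.

(** The divided difference, between [1 - t] and [1], of the polynomial
    [u (u - e) ... (u - (i-1) e)].  The recursion is the Leibniz rule for
    divided differences; unlike a quotient by [t], it stays bounded as [t]
    tends to [0]. *)
Fixpoint sffact_dd e t i : F :=
  if i is i'.+1 then (1 - i'%:R * e - t) * sffact_dd e t i' + sffact e i'
  else 0.

End FallingFactorial.

Lemma sffactE (F : fieldType) (n i : nat) : n%:R != 0 :> F ->
  sffact (n%:R^-1 : F) i * n%:R ^+ i = (n ^_ i)%:R.
Proof.
move=> n0; elim: i => [|i IH] /=; first by rewrite mulr1 ffactn0.
rewrite ffactnSr natrM -IH exprS.
case: (leqP i n) => [lin|lni].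
  by rewrite natrB //; field.
suff -> : sffact (n%:R^-1 : F) i * n%:R ^+ i = 0.
  by rewrite mul0r; rewrite mulrACA IH ffact_small // mulr0.
by rewrite IH ffact_small.
Qed.

(** The defining property of the divided difference, when both nodes are
    multiples of [1/n]. *)
Lemma sffact_ddE (F : fieldType) (n r i : nat) : n%:R != 0 :> F -> (r <= n)%N ->
  let e : F := n%:R^-1 in
  r%:R * e * sffact_dd e (r%:R * e) i
  = sffact e i - ((n - r) ^_ i)%:R / n%:R ^+ i.
Proof.
move=> n0 ler /=; elim: i => [|i IH] /=.
  by rewrite mulr0 ffactn0 expr0 divr1 subrr.
set e : F := n%:R^-1 in IH *.
rewrite ffactnSr natrM mulrDr mulrCA IH exprS.
have -> : ((n - r) ^_ i)%:R * (n - r - i)%:R = 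
          ((n - r) ^_ i)%:R * (n%:R - r%:R - i%:R) :> F.
  case: (leqP i (n - r)) => h; first by rewrite !natrB.
  by rewrite ffact_small // !mul0r.
have -> : n%:R - r%:R - i%:R = n%:R * (1 - i%:R * e - r%:R * e) :> F.
  by rewrite /e; field.
have -> : ((n - r) ^_ i)%:R * (n%:R * (1 - i%:R * e - r%:R * e)) /
   (n%:R * n%:R ^+ i) = ((n - r) ^_ i)%:R / n%:R ^+ i * (1 - i%:R * e - r%:R * e).
  by field; rewrite expf_neq0 // n0.
ring.
Qed.

Section DividedDifferenceBounds.
Variable R : realType.
Implicit Types (e t : R[i]) (T : R).

(** The quantity [T], an upper bound of [1 + |t|], measures all growth below:
    each step of the recursions costs one factor [T]. *)
Lemma nm_factor e t T i : nm e <= 1 -> 1 + nm t <= T ->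
  nm (1 - i%:R * e - t) <= i.+1%:R * T.
Proof.
move=> he hT; apply: le_trans (nmB _ _) _.
have h1 := nmB 1 (i%:R * e); rewrite nm1 nmM nm_nat in h1.
have h2 : i%:R * nm e <= i%:R by rewrite ler_piMr.
have h3 : (i%:R : R) <= i%:R * T.
  by rewrite ler_peMr // (le_trans _ hT) // lerDl nm_ge0.
rewrite -addn1 natrD mulrDl mul1r; lra.
Qed.

Lemma sffact_bound i : exists2 C : R, 0 <= C &
  forall e, nm e <= 1 -> nm (sffact e i) <= C /\ nm (sffact e i - 1) <= C * nm e.
Proof.
elim: i => [|i [C C0 IH]].
  by exists 1 => // e he /=; rewrite nm1 subrr nm0 mul1r nm_ge0.
exists (i.+1%:R * C + i%:R) => [|e he].
  by rewrite addr_ge0 // mulr_ge0.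
have [h1 h2] := IH _ he; rewrite /=.
have hf := @nm_factor e 0 1 i he; rewrite subr0 nm0 addr0 mulr1 in hf.
split.
  rewrite nmM; apply: (@le_trans _ _ (i.+1%:R * C)); last by rewrite lerDl.
  by apply: ler_pM; rewrite ?nm_ge0 // hf.
have -> : (1 - i%:R * e) * sffact e i - 1 =
          (1 - i%:R * e) * (sffact e i - 1) - i%:R * e by ring.
apply: le_trans (nmB _ _) _; rewrite !nmM nm_nat mulrDl lerD2r -mulrA.
by apply: ler_pM; rewrite ?nm_ge0 // hf.
Qed.

(** The natural exponent of [T] is [i - 1].  Both sides are multiplied by
    [T], here and in all later estimates, so that [i = 0], where the divided
    difference vanishes, needs no separate form. *)
Lemma sffact_dd_bound i : exists2 C : R, 0 <= C &
  forall e t T, nm e <= 1 -> 1 + nm t <= T ->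
    T * nm (sffact_dd e t i) <= C * T ^+ i /\
    T * nm (sffact_dd e t i - sffact_dd 0 t i) <= C * nm e * T ^+ i.
Proof.
elim: i => [|i [C C0 IH]].
  exists 0 => // e t T he hT /=.
  by rewrite subrr nm0 !mulr0 !mul0r.
have [D D0 hD] := sffact_bound i.
exists (i.+1%:R * C + i%:R * C + D) => [|e t T he hT].
  by rewrite !addr_ge0 // mulr_ge0.
have T1 : 1 <= T by rewrite (le_trans _ hT) // lerDl nm_ge0.
have T0 : 0 <= T by rewrite (le_trans _ T1).
have [h1 h2] := IH _ _ _ he hT.
have [h3 h4] := hD _ he.
have hf := @nm_factor e t T i he hT.
have TS : T <= T ^+ i.+1 by rewrite ler_eXnr.
have TiS : T ^+ i <= T ^+ i.+1 by rewrite ler_weXn2l.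
have Ti0 : 0 <= T ^+ i.+1 by rewrite exprn_ge0.
have e0 := nm_ge0 e.
have n0 : nm (0 : R[i]) <= 1 by rewrite nm0.
rewrite /=; split.
  have H := nmD ((1 - i%:R * e - t) * sffact_dd e t i) (sffact e i).
  apply: le_trans (ler_wpM2l T0 H) _.
  rewrite mulrDr [X in _ <= X]mulrDl; apply: lerD.
    rewrite nmM mulrCA exprS mulrDl.
    apply: (@le_trans _ _ (i.+1%:R * C * (T * T ^+ i))).
      have -> : i.+1%:R * C * (T * T ^+ i) = (i.+1%:R * T) * (C * T ^+ i) by ring.
      by apply: ler_pM; rewrite ?nm_ge0 ?mulr_ge0 ?nm_ge0.
    by rewrite lerDl !mulr_ge0 // exprn_ge0.
  by rewrite mulrC; apply: ler_pM; rewrite ?nm_ge0.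
have s01 j : sffact (0 : R[i]) j = 1.
  by elim: j => //= j ->; rewrite mulr0 subr0 mulr1.
rewrite s01 mulr0 subr0.
set x := sffact_dd e t i in h1 h2 *; set y := sffact_dd 0 t i in h2 *.
have [h5 _] := IH 0 t T n0 hT; rewrite -/y in h5.
have -> : (1 - i%:R * e - t) * x + sffact e i - ((1 - t) * y + 1) =
  (1 - i%:R * e - t) * (x - y) - i%:R * e * y + (sffact e i - 1) by ring.
have H := nmD ((1 - i%:R * e - t) * (x - y) - i%:R * e * y) (sffact e i - 1).
have H2 := nmB ((1 - i%:R * e - t) * (x - y)) (i%:R * e * y).
apply: (@le_trans _ _ (T * (nm ((1 - i%:R * e - t) * (x - y)) +
  nm (i%:R * e * y) + nm (sffact e i - 1)))).
  by rewrite ler_wpM2l //; lra.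
have -> (a b c : R) : T * (a + b + c) = T * a + T * b + T * c by ring.
have -> : (i.+1%:R * C + i%:R * C + D) * nm e * T ^+ i.+1 =
  i.+1%:R * C * nm e * T ^+ i.+1 + i%:R * C * nm e * T ^+ i.+1 +
  D * nm e * T ^+ i.+1 by ring.
apply: lerD; last first.
  apply: (@le_trans _ _ (T * (D * nm e))); first by rewrite ler_wpM2l.
  by rewrite mulrC ler_wpM2l // mulr_ge0.
apply: lerD.
  rewrite nmM mulrCA exprS.
  have -> : i.+1%:R * C * nm e * (T * T ^+ i) =
     (i.+1%:R * T) * (C * nm e * T ^+ i) by ring.
  by apply: ler_pM; rewrite ?nm_ge0 ?mulr_ge0 ?nm_ge0.
rewrite !nmM nm_nat.
have -> : T * (i%:R * nm e * nm y) = i%:R * nm e * (T * nm y) by ring.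
have -> : i%:R * C * nm e * T ^+ i.+1 = i%:R * nm e * (C * T ^+ i.+1) by ring.
apply: ler_wpM2l; first by rewrite mulr_ge0.
by apply: le_trans h5 _; rewrite ler_wpM2l.
Qed.

End DividedDifferenceBounds.

(** * Nonresonance *)

Section NonResonance.
Variable R : realType.

(** The distance from [z] to the real line is positive, and at infinity
    [(1 - x) - z] grows like [x]. *)
Lemma nonreal_factor (z : R[i]) : (forall x : R, z <> x%:C) ->
  exists2 c : R, 0 < c &
    forall x : R, 0 <= x -> c * (1 + x) <= nm ((1 - x)%:C - z).
Proof.
case: z => p q hz.
have q0 : 0 < `|q|.
  by rewrite normr_gt0; apply/eqP => q0; apply: (hz p); rewrite q0.
have den0 : 0 < `|q| + (2 + `|p|) by rewrite addr_gt0 // addr_gt0 // ltr_wpDr.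
exists (`|q| / (`|q| + (2 + `|p|))) => [|x x0]; first by rewrite divr_gt0.
set D := nm _.
have hD : D = Num.sqrt ((1 - x - p) ^+ 2 + q ^+ 2).
  by rewrite /D /nm /= add0r sqrrN.
have h1 : `|1 - x - p| <= D.
  by rewrite hD -sqrtr_sqr ler_wsqrtr // lerDl sqr_ge0.
have h2 : `|q| <= D by rewrite hD -sqrtr_sqr ler_wsqrtr // lerDr sqr_ge0.
have h3 : 1 + x <= `|1 - x - p| + (2 + `|p|).
  have := ler_norm (- (1 - x - p)); have := ler_norm (- p); rewrite !normrN; lra.
rewrite mulrAC ler_pdivrMr //.
apply: (@le_trans _ _ (`|q| * (D + (2 + `|p|)))).
  by rewrite ler_wpM2l //; lra.
rewrite !mulrDr; have := ler_wpM2r (_ : 0 <= 2 + `|p|) h2.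
rewrite addr_ge0 // => /(_ isT); rewrite mulrDr; lra.
Qed.

Lemma sffact_dd0E (x : R[i]) (i : nat) :
  x * sffact_dd 0 x i = 1 - (1 - x) ^+ i.
Proof.
elim: i => [|i IH] /=; first by rewrite mulr0 subrr.
have -> : sffact (0 : R[i]) i = 1.
  by elim: i {IH} => //= i ->; rewrite mulr0 subr0 mulr1.
rewrite mulr0 subr0 mulrDr mulrCA IH exprS; ring.
Qed.

Variables (k : nat) (a : 'I_k.+1 -> R[i]) (beta : 'I_k -> R[i]).
Hypothesis a0 : a ord_max != 0.
Hypothesis betaE : \sum_(i < k.+1) a i *: 'X^i =
  a ord_max *: \prod_(i < k) ('X - (beta i)%:P).
Hypothesis beta_neq0 : forall j, beta j != 0.
Hypothesis beta_line : forall (i j : 'I_k) (x : R),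
  i != j -> beta i <> x%:C * beta j.

(** The polynomial [sum_i a_i u^i] vanishes at [beta j], so its divided
    difference between [beta j] and [(1 - x) beta j] is its value at the second
    point divided by [- x beta j].  In the factorization over the [beta i], the
    factor of index [j] is [- x beta j] and cancels; [nonreal_factor] bounds the
    others. *)
Lemma nonresonance_limit (j : 'I_k) : exists2 c : R, 0 < c &
  forall x : R, 0 < x -> c * (1 + x) ^+ k <=
    (1 + x) * nm (\sum_(i < k.+1) a i * beta j ^+ i * sffact_dd 0 x%:C i).
Proof.
have : forall i : 'I_k, exists c : R, 0 < c /\ (i != j ->
    forall x : R, 0 <= x -> c * (1 + x) <= nm ((1 - x)%:C * beta j - beta i)).
  move=> i; case: (eqVneq i j) => [_|ij]; first by exists 1.
  have [x h|c c0 hc] := @nonreal_factor (beta i / beta j).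
    by apply: (@beta_line i j x ij); rewrite -h divfK.
  exists (c * nm (beta j)); split=> [|_ x x0].
    by rewrite mulr_gt0 // nm_gt0.
  have -> : (1 - x)%:C * beta j - beta i = ((1 - x)%:C - beta i / beta j) * beta j.
    by field.
  by rewrite nmM mulrAC ler_wpM2r ?nm_ge0 // hc.
case/boolp.choice => c hc.
exists (nm (a ord_max) * (nm (beta j) * \prod_(i < k | i != j) c i)) => [|x x0].
  rewrite mulr_gt0 ?nm_gt0 // mulr_gt0 ?nm_gt0 // prodr_gt0 // => i _.
  by have [] := hc i.
have x0' : x%:C != 0 :> R[i].
  by rewrite -nm_gt0 nm_real normr_gt0 gt_eqF.
have ev z : \sum_(i < k.+1) a i * z ^+ i = a ord_max * \prod_(i < k) (z - beta i).
  transitivity (\sum_(i < k.+1) a i *: 'X^i).[z].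
    by rewrite horner_sum; apply: eq_bigr => i _; rewrite hornerZ hornerXn.
  rewrite betaE hornerZ horner_prod; congr (_ * _).
  by apply: eq_bigr => i _; rewrite hornerXsubC.
have -> : \sum_(i < k.+1) a i * beta j ^+ i * sffact_dd 0 x%:C i =
  a ord_max * (beta j * \prod_(i < k | i != j) ((1 - x)%:C * beta j - beta i)).
  apply: (mulfI x0'); rewrite big_distrr /=.
  transitivity (\sum_(i < k.+1) a i * beta j ^+ i -
                \sum_(i < k.+1) a i * ((1 - x)%:C * beta j) ^+ i).
    rewrite -sumrB; apply: eq_bigr => i _.
    by rewrite mulrCA sffact_dd0E rmorphB /= exprMn; ring.
  rewrite !ev !(bigD1 j (P := xpredT)) //= subrr mul0r mulr0 sub0r.
  by rewrite rmorphB /=; ring.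
rewrite !nmM nm_prod.
have -> (u b p : R) : (1 + x) * (u * (b * p)) = u * (b * ((1 + x) * p)) by ring.
rewrite -mulrA ler_wpM2l ?nm_ge0 // -mulrA ler_wpM2l ?nm_ge0 //.
have -> : (1 + x) ^+ k = (1 + x) * \prod_(i < k | i != j) (1 + x).
  by rewrite -[k in LHS]card_ord -prodr_const (bigD1 j).
rewrite mulrCA ler_wpM2l //; first by lra.
rewrite -big_split /=; apply: ler_prod => i ij.
have [c0 /(_ ij x (ltW x0)) h] := hc i.
by rewrite h andbT mulr_ge0 // ?ltW //; lra.
Qed.

Lemma power_lipschitz (b : R[i]) i : exists2 C : R, 0 <= C &
  forall v, nm (v - b) <= 1 ->
    nm (v ^+ i) <= C /\ nm (v ^+ i - b ^+ i) <= C * nm (v - b).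
Proof.
elim: i => [|i [C C0 IH]].
  by exists 1 => // v hv; rewrite expr0 subrr nm1 nm0 mul1r nm_ge0.
exists ((1 + nm b) * C + nm b ^+ i) => [|v hv].
  by rewrite addr_ge0 ?mulr_ge0 ?exprn_ge0 ?addr_ge0 ?nm_ge0.
have [h1 h2] := IH v hv.
have hvb : nm v <= 1 + nm b.
  by have := nmD (v - b) b; rewrite subrK; lra.
have p0 : 0 <= nm b ^+ i by rewrite exprn_ge0 ?nm_ge0.
rewrite !exprS; split.
  rewrite nmM; apply: (@le_trans _ _ ((1 + nm b) * C)); last by rewrite lerDl.
  by apply: ler_pM; rewrite ?nm_ge0.
have -> : v * v ^+ i - b * b ^+ i = v * (v ^+ i - b ^+ i) + (v - b) * b ^+ i by ring.
apply: le_trans (nmD _ _) _; rewrite !nmM mulrDl nmX; apply: lerD.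
  by rewrite -mulrA; apply: ler_pM; rewrite ?nm_ge0.
by rewrite mulrC.
Qed.

(** The sums at [(e, v)] and at [(0, beta j)] differ by at most a constant
    times [|e| + |v - beta j|] times the growth factor [(1 + x)^k], so that the
    lower bound of the limit case survives, uniformly in [x]. *)
Lemma nonresonance (j : 'I_k) : exists c eta : R, [/\ 0 < c, 0 < eta &
  forall (e v : R[i]) (x : R), nm e <= eta -> nm (v - beta j) <= eta -> 0 < x ->
    c * (1 + x) ^+ k <=
    (1 + x) * nm (\sum_(i < k.+1) a i * v ^+ i * sffact_dd e x%:C i)].
Proof.
have [c c0 hc] := nonresonance_limit j.
set b := beta j in hc *.
have : forall i : 'I_k.+1, exists D : R, 0 <= D /\
    forall (e v : R[i]) (x : R), nm e <= 1 -> nm (v - b) <= 1 -> 0 <= x ->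
    (1 + x) * nm (a i * v ^+ i * sffact_dd e x%:C i -
                  a i * b ^+ i * sffact_dd 0 x%:C i)
    <= D * (nm e + nm (v - b)) * (1 + x) ^+ k.
  move=> i.
  have [C C0 hC] := power_lipschitz b i.
  have [D D0 hD] := sffact_dd_bound R i.
  exists (nm (a i) * (C * D)); split=> [|e v x he hv x0].
    by rewrite mulr_ge0 ?nm_ge0 // mulr_ge0.
  have hT : 1 + nm x%:C <= 1 + x by rewrite nm_real ger0_norm.
  have [h1 h2] := hC _ hv.
  have [_ h4] := hD e x%:C _ he hT.
  have [|h3 _] := hD 0 x%:C _ _ hT; first by rewrite nm0.
  set y := sffact_dd e _ _ in h4 *; set y0 := sffact_dd 0 _ _ in h3 h4 *.
  have -> : a i * v ^+ i * y - a i * b ^+ i * y0 =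
     a i * (v ^+ i * (y - y0) + (v ^+ i - b ^+ i) * y0) by ring.
  have T0 : 0 <= 1 + x by lra.
  have Tik : (1 + x) ^+ i <= (1 + x) ^+ k.
    by apply: ler_weXn2l; [lra | rewrite -ltnS].
  rewrite nmM mulrCA -2!mulrA ler_wpM2l ?nm_ge0 //.
  apply: le_trans (ler_wpM2l T0 (nmD _ _)) _; rewrite !nmM mulrDr.
  apply: (@le_trans _ _ (C * D * (nm e + nm (v - b)) * (1 + x) ^+ i)); last first.
    by rewrite -!mulrA ler_wpM2l // ler_wpM2l // ler_wpM2l // addr_ge0 // nm_ge0.
  rewrite mulrDr mulrDl; apply: lerD.
    rewrite mulrCA -!mulrA; apply: ler_pM; rewrite ?mulr_ge0 ?nm_ge0 //.
    by rewrite mulrA.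
  rewrite mulrCA [X in _ <= X](_ : _ = C * nm (v - b) * (D * (1 + x) ^+ i)).
    by apply: ler_pM; rewrite ?mulr_ge0 ?nm_ge0.
  by ring.
case/boolp.choice => D hD.
pose S := \sum_(i < k.+1) D i.
have S0 : 0 <= S by apply: sumr_ge0 => i _; case: (hD i).
pose eta : R := Num.min 1 (c / (4 * (S + 1))).
have eta0 : 0 < eta.
  by rewrite lt_min ltr01 divr_gt0 // mulr_gt0 //; lra.
have eta1 : eta <= 1 by rewrite ge_min lexx.
have Seta : 4 * (S * eta) <= c.
  have : eta <= c / (4 * (S + 1)) by rewrite ge_min lexx orbT.
  by rewrite ler_pdivlMr ?mulr_gt0 //; nra.
exists (c / 2), eta; split=> //; first by rewrite divr_gt0.
move=> e v x he hv x0.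
set H := \sum_i _; set T := 1 + x.
have T0 : 0 <= T by rewrite /T; lra.
have Tk0 : 0 <= T ^+ k by rewrite exprn_ge0.
have := hc x x0; rewrite -/T; set H0 := \sum_i _ => hH0.
have hd : T * nm (H - H0) <= S * (2 * eta) * T ^+ k.
  rewrite /H /H0 -sumrB.
  apply: le_trans (ler_wpM2l T0 (nm_sum _ _ _)) _.
  rewrite mulr_sumr /S !mulr_suml; apply: ler_sum => i _.
  have [Di0 h] := hD i.
  apply: le_trans (h e v x (le_trans he eta1) (le_trans hv eta1) (ltW x0)) _.
  by rewrite ler_wpM2r // ler_wpM2l //; lra.
have hn : nm H0 <= nm H + nm (H - H0).
  by have := nmB H (H - H0); rewrite opprB addrC subrK.
have hn' := ler_wpM2l T0 hn; rewrite mulrDr in hn'.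
have h5 : S * (2 * eta) * T ^+ k <= c / 2 * T ^+ k by rewrite ler_wpM2r //; lra.
have h6 : c / 2 * T ^+ k = c * T ^+ k - c / 2 * T ^+ k by field.
lra.
Qed.

End NonResonance.

(** * The Riccati equation and its majorant *)

Section Riccati.
Variable F : comNzRingType.
Implicit Types (w : {poly F}) (e : F) (i r : nat).

(** If [e = 1/n] and [z p' / p = n w], this is [e^i z^i p^(i) / p], obtained
    by letting the operators [w - i' e + e z d/dz], [i' < i], act on [1].
    Polynomials represent power series in [x = 1/z] modulo a power of [x], and
    [z d/dz = - x d/dx]. *)
Fixpoint riccati w e i : {poly F} :=
  if i is i'.+1 then
    w * riccati w e i' - (i'%:R * e) *: riccati w e i'
      - e *: ('X * (riccati w e i')^`())
  else 1.

Lemma coef_riccatiS w e i r :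
  (riccati w e i.+1)`_r = \sum_(s < r.+1) w`_s * (riccati w e i)`_(r - s)
    - (i%:R * e + r%:R * e) * (riccati w e i)`_r.
Proof.
rewrite /= !coefB !coefZ coefM coefXM coef_deriv mulrDl opprD addrA.
congr (_ - _); case: r => [|r] /=; first by rewrite !mul0r mulr0.
by rewrite -mulr_natl; ring.
Qed.

(** The coefficient of index [r] is affine in [w_r] once the [w_s] with
    [s < r] are given; this is what remains of it after removing the term in
    [w_r].  That the slope is a divided difference comes from the first order
    perturbation of a solution, by [x^r], in the Euler operator. *)
Definition riccati_nl w e i r : F :=
  (riccati w e i)`_r - sffact_dd e (r%:R * e) i * w`_r.

Lemma riccati_coef0 w e i : w`_0 = 1 -> (riccati w e i)`_0 = sffact e i.
Proof.
move=> w0; elim: i => [|i IH]; first by rewrite coef1.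
by rewrite coef_riccatiS big_ord1 w0 subn0 IH mul0r addr0 /=; ring.
Qed.

Lemma riccati_nlS w e i r : w`_0 = 1 ->
  riccati_nl w e i.+1 r.+1 =
    (1 - i%:R * e - r.+1%:R * e) * riccati_nl w e i r.+1 +
    \sum_(s < r) w`_s.+1 * (riccati w e i)`_(r - s).
Proof.
move=> w0; rewrite /riccati_nl coef_riccatiS big_ord_recl big_ord_recr /=.
rewrite subn0 subnn riccati_coef0 // w0.
by under eq_bigr => s _ do rewrite subSS; ring.
Qed.

End Riccati.

(** The factor [1/(s+1)^2] makes these weights stable under convolution up to
    a constant ([wgt_conv]).  Locking prevents lemmas on products from seeing
    through the definition. *)
HB.lock Definition wgt (R : realType) (M : R) (s : nat) : R :=
  M ^+ s / s.+1%:R ^+ 2.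

Section Majorant.
Variable R : realType.
Implicit Types (M : R) (s r : nat).

Lemma wgtE M s : wgt M s = M ^+ s / s.+1%:R ^+ 2.
Proof. by rewrite wgt.unlock. Qed.

Lemma wgt_ge0 M s : 0 <= M -> 0 <= wgt M s.
Proof. by move=> M0; rewrite wgtE divr_ge0 ?exprn_ge0. Qed.

Lemma sum_inv_sqr_le1 r : \sum_(s < r) (s.+2%:R ^+ 2)^-1 <= 1 :> R.
Proof.
suff h : \sum_(s < r) (s.+2%:R ^+ 2)^-1 <= 1 - r.+1%:R^-1 :> R.
  by apply: le_trans h _; rewrite gerBl invr_ge0.
elim: r => [|r IH]; first by rewrite big_ord0 invr1 subrr.
rewrite big_ord_recr /=; apply: le_trans (lerD IH (lexx _)) _.
set x : R := r.+1%:R; have -> : r.+2%:R = x + 1 :> R by rewrite -natr1.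
have x0 : 0 < x by rewrite ltr0n.
have -> : 1 - (x + 1)^-1 = 1 - x^-1 + (x * (x + 1))^-1.
  by field; rewrite !gt_eqF //; lra.
rewrite lerD2l lef_pV2 ?posrE ?exprn_gt0 ?mulr_gt0 //; first by nra.
all: lra.
Qed.

(** Write [1/(x y) = (1/x + 1/y)/(x + y)] and use the convergence of
    [sum 1/s^2]. *)
Lemma wgt_conv M r : 0 <= M ->
  \sum_(s < r) wgt M s.+1 * wgt M (r - s) <= 4 * wgt M r.+1.
Proof.
move=> M0.
have hs (s : 'I_r) : wgt M s.+1 * wgt M (r - s) <=
    2 * wgt M r.+1 * ((s.+2%:R ^+ 2)^-1 + ((r - s).+1%:R ^+ 2)^-1).
  rewrite !wgtE mulrACA -exprD addSn subnKC 1?ltnW //.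
  have -> (u v z : R) : 2 * (u / z) * v = u * (2 / z * v) by ring.
  rewrite -invfM ler_wpM2l ?exprn_ge0 //.
  set x : R := s.+2%:R; set y : R := (r - s).+1%:R; set z : R := r.+2%:R.
  have x0 : 0 < x by rewrite ltr0n.
  have y0 : 0 < y by rewrite ltr0n.
  have z0 : 0 < z by rewrite ltr0n.
  have zxy : z <= x + y by rewrite -natrD ler_nat; have := ltn_ord s; lia.
  have -> : 2 / z ^+ 2 * ((x ^+ 2)^-1 + (y ^+ 2)^-1) =
     (x ^+ 2 * y ^+ 2)^-1 * (2 * (x ^+ 2 + y ^+ 2) / z ^+ 2).
    by field; rewrite !gt_eqF.
  rewrite ler_peMr ?invr_ge0 ?mulr_ge0 ?sqr_ge0 //.
  rewrite ler_pdivlMr ?exprn_gt0 // mul1r.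
  have : z ^+ 2 <= (x + y) ^+ 2 by rewrite ler_sqr ?nnegrE; lra.
  have := sqr_ge0 (x - y); rewrite !expr2; nra.
apply: (@le_trans _ _ (\sum_(s < r)
    2 * wgt M r.+1 * ((s.+2%:R ^+ 2)^-1 + ((r - s).+1%:R ^+ 2)^-1))).
  by apply: ler_sum => s _; exact: hs.
rewrite -mulr_sumr big_split /=.
have -> : \sum_(s < r) ((r - s).+1%:R ^+ 2)^-1 = \sum_(s < r) (s.+2%:R ^+ 2)^-1 :> R.
  rewrite (reindex_inj rev_ord_inj) /=; apply: eq_bigr => s _.
  by rewrite subKn.
have h := sum_inv_sqr_le1 r; have w0 := wgt_ge0 r.+1 M0.
have -> : 4 * wgt M r.+1 = 2 * wgt M r.+1 * 2 by ring.
apply: ler_wpM2l; first exact: (mulr_ge0 (ler0n _ 2) w0).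
exact: (lerD h h).
Qed.

(** A shift by [d] gains [M^-d], hence a factor as small as desired for large
    [M]; the denominators change by a bounded factor. *)
Lemma wgt_shift M k d r : 1 <= M -> (0 < d <= k)%N -> (d <= r)%N ->
  wgt M (r - d) <= k.+1%:R ^+ 2 / M * wgt M r.
Proof.
move=> M1 /andP[d0 dk] dr; have M0 : 0 < M by rewrite (lt_le_trans _ M1).
rewrite !wgtE ler_pdivrMr ?exprn_gt0 //.
have -> : k.+1%:R ^+ 2 / M * (M ^+ r / r.+1%:R ^+ 2) * (r - d).+1%:R ^+ 2 =
  M ^+ r.-1 * ((k.+1%:R * (r - d).+1%:R) ^+ 2 / r.+1%:R ^+ 2).
  have -> : M ^+ r = M * M ^+ r.-1 by rewrite -exprS prednK // (leq_trans d0).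
  by field; rewrite !gt_eqF.
rewrite -[X in X <= _]mulr1; apply: ler_pM; rewrite ?exprn_ge0 ?(ltW M0) //.
  by apply: ler_weXn2l => //; lia.
rewrite ler_pdivlMr ?exprn_gt0 // mul1r ler_sqr ?nnegrE //.
by rewrite -natrM ler_nat; nia.
Qed.

Definition majorized (w : {poly R[i]}) (delta M : R) r :=
  forall s, (0 < s < r)%N -> nm w`_s <= delta * wgt M s.

(** The nonlinear part is quadratic in the small constant [delta]: each of its
    terms contains at least two coefficients of positive index, and [wgt_conv]
    absorbs the convolutions.  The powers of [T] come from the derivatives. *)
Lemma riccati_bound i : exists2 C : R, 0 <= C &
  forall (e : R[i]) (w : {poly R[i]}) (delta M T : R) r,
    nm e <= 1 -> w`_0 = 1 -> 0 <= delta <= 1 -> 0 <= M ->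
    1 + r%:R * nm e <= T -> majorized w delta M r ->
    ((0 < r)%N -> T * nm (riccati_nl w e i r) <= C * delta ^+ 2 * wgt M r * T ^+ i) /\
    (forall s, (0 < s < r)%N ->
       T * nm (riccati w e i)`_s <= C * delta * wgt M s * T ^+ i).
Proof.
elim: i => [|i [C C0 IH]].
  exists 0 => // e w delta M T r _ _ _ _ _ _; split.
    case: r => // r _; rewrite /riccati_nl /= coef1 mul0r subr0 nm0.
    by rewrite mulr0 !mul0r.
  by case=> // s _; rewrite /= coef1 nm0 mulr0 !mul0r.
have [D D0 hD] := sffact_dd_bound R i.+1.
pose C1 := i.+1%:R * C + 4 * C.
have C10 : 0 <= C1 by rewrite addr_ge0 // mulr_ge0.
have nlb (e : R[i]) (w : {poly R[i]}) (delta M T : R) (r : nat) : nm e <= 1 -> w`_0 = 1 -> 0 <= delta <= 1 -> 0 <= M ->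
    1 + r%:R * nm e <= T -> majorized w delta M r -> (0 < r)%N ->
    T * nm (riccati_nl w e i.+1 r) <= C1 * delta ^+ 2 * wgt M r * T ^+ i.+1.
  move=> he w0 /[dup] hd /andP[d0 d1] M0 hT hw; case: r hT hw => // r hT hw _.
  have [/(_ isT) h1 h2] := IH e w delta M T r.+1 he w0 hd M0 hT hw.
  have T1 : 1 <= T by rewrite (le_trans _ hT) // lerDl mulr_ge0 // nm_ge0.
  have T0 : 0 <= T by rewrite (le_trans _ T1).
  have W0 := wgt_ge0 r.+1 M0.
  rewrite riccati_nlS //; apply: le_trans (ler_wpM2l T0 (nmD _ _)) _.
  have -> : C1 * delta ^+ 2 * wgt M r.+1 * T ^+ i.+1 =
    (i.+1%:R * T) * (C * delta ^+ 2 * wgt M r.+1 * T ^+ i) +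
    4 * C * delta ^+ 2 * wgt M r.+1 * T ^+ i.+1 by rewrite (exprS T) /C1; ring.
  rewrite mulrDr; apply: lerD.
    rewrite nmM mulrCA.
    apply: ler_pM; rewrite ?mulr_ge0 ?nm_ge0 //.
    by apply: nm_factor => //; rewrite nmM nm_nat.
  apply: (@le_trans _ _ (C * delta ^+ 2 * T ^+ i * (4 * wgt M r.+1))).
    apply: le_trans (ler_wpM2l T0 (nm_sum _ _ _)) _.
    apply: le_trans (ler_wpM2l _ (wgt_conv r M0)); last first.
      by rewrite !mulr_ge0 ?exprn_ge0.
    rewrite !mulr_sumr; apply: ler_sum => s _; rewrite nmM mulrCA.
    have -> : C * delta ^+ 2 * T ^+ i * (wgt M s.+1 * wgt M (r - s)) =
       delta * wgt M s.+1 * (C * delta * wgt M (r - s) * T ^+ i) by ring.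
    have sr := ltn_ord s.
    apply: ler_pM; rewrite ?mulr_ge0 ?nm_ge0 //; last first.
      by apply: h2; rewrite subn_gt0 sr ltnS leq_subr.
    by apply: hw; rewrite /= ltnS.
  have -> : 4 * C * delta ^+ 2 * wgt M r.+1 * T ^+ i.+1 =
     C * delta ^+ 2 * T ^+ i.+1 * (4 * wgt M r.+1) by ring.
  rewrite ler_wpM2r ?mulr_ge0 // ler_wpM2l ?mulr_ge0 ?sqr_ge0 //.
  by apply: ler_weXn2l.
exists (C1 + D); first by rewrite addr_ge0.
move=> e w delta M T r he w0 /[dup] hd /andP[d0 d1] M0 hT hw.
have T1 : 1 <= T by rewrite (le_trans _ hT) // lerDl mulr_ge0 // nm_ge0.
have T0 : 0 <= T by rewrite (le_trans _ T1).
have Ti0 : 0 <= T ^+ i.+1 by rewrite exprn_ge0.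
split=> [r0|s /[dup] hs /andP[s0 sr]].
  apply: le_trans (nlb _ _ _ _ _ _ he w0 hd M0 hT hw r0) _.
  rewrite ler_wpM2r // ler_wpM2r ?wgt_ge0 // ler_wpM2r ?sqr_ge0 //.
  by rewrite lerDl.
have hTs : 1 + s%:R * nm e <= T.
  by apply: le_trans hT; rewrite lerD2l ler_wpM2r ?nm_ge0 // ler_nat ltnW.
have hws : majorized w delta M s.
  by move=> s' /andP[h1 h2]; apply: hw; rewrite h1 (ltn_trans h2).
have h1 := nlb _ _ _ _ _ _ he w0 hd M0 hTs hws s0.
have hTs' : 1 + nm (s%:R * e) <= T by rewrite nmM nm_nat.
have [h2 _] := hD e (s%:R * e) T he hTs'.
have -> : (riccati w e i.+1)`_s =
    riccati_nl w e i.+1 s + sffact_dd e (s%:R * e) i.+1 * w`_s.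
  by rewrite /riccati_nl subrK.
apply: le_trans (ler_wpM2l T0 (nmD _ _)) _.
rewrite mulrDr.
have -> : (C1 + D) * delta * wgt M s * T ^+ i.+1 =
  C1 * delta * wgt M s * T ^+ i.+1 + D * delta * wgt M s * T ^+ i.+1 by ring.
apply: lerD.
  apply: le_trans h1 _; rewrite ler_wpM2r // ler_wpM2r ?wgt_ge0 //.
  by rewrite ler_wpM2l // expr2 ler_piMl.
rewrite nmM mulrA.
have -> : D * delta * wgt M s * T ^+ i.+1 = D * T ^+ i.+1 * (delta * wgt M s) by ring.
by apply: ler_pM; rewrite ?mulr_ge0 ?nm_ge0 //; apply: hw.
Qed.

Lemma coef_mul_trunc (F : comNzRingType) (k : nat) (q P : {poly F}) r :
  (size q <= k.+1)%N ->
  (q * P)`_r = \sum_(d < k.+1) q`_d * ('X^d * P)`_r.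
Proof.
move=> sq.
have {1}-> : q = \sum_(d < k.+1) q`_d *: 'X^d.
  apply/polyP => j; rewrite -[RHS]/((\sum_(d < k.+1) q`_d *: 'X^d)`_j).
  rewrite -(poly_def k.+1 (fun d => q`_d)) coef_poly.
  by case: ltnP => // h; rewrite nth_default // (leq_trans sq).
rewrite mulr_suml coef_sum; apply: eq_bigr => d _.
by rewrite -scalerAl coefZ.
Qed.

Lemma riccati_bounds k : exists2 C : R, 0 <= C &
  forall (i : 'I_k.+1) (e : R[i]) (w : {poly R[i]}) (delta M T : R) r,
    (0 < k)%N -> nm e <= 1 -> w`_0 = 1 -> 0 <= delta <= 1 -> 0 <= M ->
    1 + r%:R * nm e <= T -> majorized w delta M r ->
    ((0 < r)%N -> T * nm (riccati_nl w e i r) <= C * delta ^+ 2 * wgt M r * T ^+ k) /\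
    (forall s, (s < r)%N -> T * nm (riccati w e i)`_s <= C * wgt M s * T ^+ k).
Proof.
have : forall i : 'I_k.+1, exists C : R, 0 <= C /\
  forall (e : R[i]) (w : {poly R[i]}) (delta M T : R) r,
    (0 < k)%N -> nm e <= 1 -> w`_0 = 1 -> 0 <= delta <= 1 -> 0 <= M ->
    1 + r%:R * nm e <= T -> majorized w delta M r ->
    ((0 < r)%N -> T * nm (riccati_nl w e i r) <= C * delta ^+ 2 * wgt M r * T ^+ k) /\
    (forall s, (s < r)%N -> T * nm (riccati w e i)`_s <= C * wgt M s * T ^+ k).
  move=> i; have [C C0 hC] := riccati_bound i.
  have [D D0 hD] := sffact_bound R i.
  exists (C + D); split; first by rewrite addr_ge0.
  move=> e w delta M T r k0 he w0 /[dup] hd /andP[d0 d1] M0 hT hw.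
  have [h1 h2] := hC _ _ _ _ _ _ he w0 hd M0 hT hw.
  have T1 : 1 <= T by rewrite (le_trans _ hT) // lerDl mulr_ge0 // nm_ge0.
  have T0 : 0 <= T by rewrite (le_trans _ T1).
  have Tik : T ^+ i <= T ^+ k by apply: ler_weXn2l => //; rewrite -ltnS.
  split=> [r0|s sr].
    apply: le_trans (h1 r0) _; apply: ler_pM; rewrite ?mulr_ge0 ?exprn_ge0 ?wgt_ge0 //.
    by rewrite ler_wpM2r ?wgt_ge0 // ler_wpM2r ?sqr_ge0 // lerDl.
  case: s sr => [|s] sr.
    rewrite riccati_coef0 // wgtE expr0 expr1n divr1 mulr1 mulrC.
    apply: ler_pM; rewrite ?nm_ge0 //.
      by have [+ _] := hD _ he => /le_trans; apply; rewrite lerDr.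
    by rewrite ler_eXnr.
  apply: le_trans (h2 _ _) _; first by rewrite /= sr.
  apply: ler_pM; rewrite ?mulr_ge0 ?exprn_ge0 ?wgt_ge0 //.
  rewrite ler_wpM2r ?wgt_ge0 //.
  by rewrite (@le_trans _ _ C) ?lerDl // ler_piMr.
case/boolp.choice => C hC.
exists (\sum_(i < k.+1) C i); first by apply: sumr_ge0 => i _; case: (hC i).
move=> i e w delta M T r k0 he w0 hd M0 hT hw.
have [Ci0 /(_ e w delta M T r k0 he w0 hd M0 hT hw) [h1 h2]] := hC i.
have CS : C i <= \sum_(i < k.+1) C i.
  by rewrite (bigD1 i) //= lerDl; apply: sumr_ge0 => l _; case: (hC l).
have T0 : 0 <= T by rewrite (le_trans _ hT) // addr_ge0 ?mulr_ge0 ?nm_ge0.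
split=> [r0|s sr].
  apply: le_trans (h1 r0) _.
  by rewrite ler_wpM2r ?exprn_ge0 // ler_wpM2r ?wgt_ge0 // ler_wpM2r ?sqr_ge0.
apply: le_trans (h2 s sr) _.
by rewrite ler_wpM2r ?exprn_ge0 // ler_wpM2r ?wgt_ge0.
Qed.

(** Induction on [r] with the hypothesis [|w_s| <= delta * wgt M s].  In the
    equation for [w_r] the nonlinear part contributes [O(delta^2)] and the
    coefficients [q_d], [d > 0], contribute [O(1/M)]; both carry the factor [T^k],
    which the lower bound on the slope removes.  It remains to choose [delta]
    small and then [M] large. *)
Lemma riccati_majorant (k : nat) (K c : R) : (0 < k)%N -> 0 <= K -> 0 < c ->
  exists2 M : R, 1 <= M &
  forall (e : R[i]) (w : {poly R[i]}) (q : 'I_k.+1 -> {poly R[i]}) (N : nat),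
    nm e <= 1 -> w`_0 = 1 ->
    (forall i, (size (q i) <= k.+1)%N) -> (forall i d, nm (q i)`_d <= K) ->
    (forall r, (0 < r)%N -> c * (1 + r%:R * nm e) ^+ k <=
       (1 + r%:R * nm e) *
       nm (\sum_(i < k.+1) (q i)`_0 * sffact_dd e (r%:R * e) i)) ->
    (forall r, (0 < r < N)%N -> (\sum_(i < k.+1) q i * riccati w e i)`_r = 0) ->
    forall r, (0 < r < N)%N -> nm w`_r <= M ^+ r.
Proof.
move=> k0 K0 c0.
have [C C0 hC] := riccati_bounds k.
(* [K1] and [K2] bound the contributions of order [delta^2] and [1/M]; the
   summand [c] makes [K1] positive and [delta] at most 1. *)
pose K1 := k.+1%:R * (K * C) + c.
have K10 : 0 < K1 by rewrite ltr_wpDl // mulr_ge0 // mulr_ge0.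
pose K2 := k.+1%:R * (k%:R * (K * C * k.+1%:R ^+ 2)).
have K20 : 0 <= K2 by rewrite !mulr_ge0 ?exprn_ge0.
pose delta := c / (2 * K1).
have d0 : 0 < delta by rewrite divr_gt0 // mulr_gt0.
have d1 : delta <= 1.
  rewrite ler_pdivrMr ?mulr_gt0 // mul1r.
  have : 0 <= k.+1%:R * (K * C) by rewrite !mulr_ge0.
  by rewrite /K1; lra.
have dE : K1 * delta = c / 2 by rewrite /delta; field; rewrite gt_eqF.
clearbody delta.
pose M := 1 + 2 * K2 / (c * delta).
have M1 : 1 <= M by rewrite lerDl divr_ge0 // mulr_ge0 // ltW.
have M0 : 0 < M by rewrite (lt_le_trans _ M1).
have ME : K2 / M <= c * delta / 2.
  rewrite ler_pdivrMr //.
  have -> : c * delta / 2 * M = c * delta / 2 + K2.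
    by rewrite /M; field; rewrite !gt_eqF.
  by rewrite lerDr divr_ge0 // mulr_ge0 ?ltW.
clearbody M; exists M => // e w q N he w0 sq qK hH hq.
suff main r : (0 < r < N)%N -> nm w`_r <= delta * wgt M r.
  move=> r hr; apply: le_trans (main r hr) _.
  rewrite -[X in _ <= X]mul1r; apply: ler_pM; rewrite ?wgt_ge0 ?(ltW d0) ?(ltW M0) //.
  rewrite wgtE ler_piMr ?exprn_ge0 ?(ltW M0) // invf_le1 ?exprn_gt0 //.
  by rewrite exprn_ege1 // ler1n.
have [m] := ubnP r; elim: m r => // m IH r; rewrite ltnS => rm /[dup] hr /andP[r0 rN].
have hw : majorized w delta M r.
  move=> s /andP[s0 sr]; apply: IH; first exact: leq_trans sr rm.
  by rewrite s0 (ltn_trans sr).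
pose T := 1 + r%:R * nm e.
have hd : 0 <= delta <= 1 by rewrite d1 ltW.
have hb i := hC i e w delta M T r k0 he w0 hd (ltW M0) (lexx _) hw.
have T0 : 0 < T by rewrite ltr_pwDl // mulr_ge0 ?nm_ge0.
have Tk0 : 0 < T ^+ k by rewrite exprn_gt0.
have W0 : 0 <= wgt M r by rewrite wgt_ge0 ?ltW.
have := hH r r0; rewrite -/T; set H := \sum_i _ => hHr.
have key : H * w`_r = - (\sum_(i < k.+1) (q i)`_0 * riccati_nl w e i r
   + \sum_(i < k.+1) \sum_(d < k) (q i)`_d.+1 *
     ('X^(d.+1) * riccati w e i : {poly R[i]})`_r).
  apply/eqP; rewrite -subr_eq0 opprK; apply/eqP; rewrite -[RHS](hq r hr) coef_sum.
  rewrite /H mulr_suml -!big_split /=; apply: eq_bigr => i _.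
  rewrite (coef_mul_trunc _ _ (sq i)) big_ord_recl expr0 mul1r addrA.
  by congr (_ + _); rewrite /riccati_nl; ring.
have hkey : T * nm (H * w`_r) <= (K1 * delta ^+ 2 + K2 / M) * (wgt M r * T ^+ k).
  rewrite key nmN; apply: le_trans (ler_wpM2l (ltW T0) (nmD _ _)) _.
  rewrite mulrDr [X in _ <= X]mulrDl; apply: lerD.
    apply: (@le_trans _ _ (k.+1%:R * (K * C) * delta ^+ 2 * (wgt M r * T ^+ k))); last first.
      rewrite ler_wpM2r ?mulr_ge0 ?(ltW Tk0) // ler_wpM2r ?sqr_ge0 //.
      by rewrite /K1 lerDl ltW.
    apply: le_trans (ler_wpM2l (ltW T0) (nm_sum _ _ _)) _.
    rewrite mulr_sumr; apply: (@le_trans _ _ (\sum_(i < k.+1) K * (C * delta ^+ 2 * wgt M r * T ^+ k))).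
      apply: ler_sum => i _; rewrite nmM mulrCA; apply: ler_pM; rewrite ?mulr_ge0 ?nm_ge0 ?(ltW T0) //.
      by have [h _] := hb i; apply: h.
    rewrite sumr_const card_ord -mulr_natl; rewrite le_eqVlt; apply/orP; left; apply/eqP; ring.
  apply: le_trans (ler_wpM2l (ltW T0) (nm_sum _ _ _)) _.
  pose B := K * (C * (k.+1%:R ^+ 2 / M * wgt M r) * T ^+ k).
  have -> : K2 / M * (wgt M r * T ^+ k) = \sum_(i < k.+1) \sum_(d < k) B.
    by rewrite !sumr_const !card_ord -[B *+ k]mulr_natl -[_ *+ k.+1]mulr_natl /K2 /B; ring.
  rewrite mulr_sumr; apply: ler_sum => i _.
  apply: le_trans (ler_wpM2l (ltW T0) (nm_sum _ _ _)) _.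
  rewrite mulr_sumr; apply: ler_sum => d _.
  rewrite nmM mulrCA; apply: ler_pM; rewrite ?mulr_ge0 ?nm_ge0 ?(ltW T0) //.
  rewrite coefXnM; case: ltnP => [_|dr].
    rewrite nm0 mulr0 mulr_ge0 ?(ltW Tk0) // mulr_ge0 // mulr_ge0 //.
    by rewrite divr_ge0 ?exprn_ge0 ?(ltW M0).
  have [_ h] := hb i; apply: le_trans (h (r - d.+1)%N _) _; first by rewrite ltn_subrL.
  rewrite ler_wpM2r ?(ltW Tk0) // ler_wpM2l //.
  by apply: wgt_shift => //=.
rewrite nmM mulrA in hkey.
have h1 : c * T ^+ k * nm w`_r <= T * nm H * nm w`_r by rewrite ler_wpM2r ?nm_ge0.
have h2 : (K1 * delta ^+ 2 + K2 / M) * (wgt M r * T ^+ k) <= c * delta * (wgt M r * T ^+ k).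
  rewrite ler_wpM2r ?mulr_ge0 ?(ltW Tk0) //.
  by rewrite expr2 mulrA dE; lra.
have h3 : (c * T ^+ k) * nm w`_r <= (c * T ^+ k) * (delta * wgt M r).
  apply: le_trans h1 (le_trans hkey (le_trans h2 _)).
  by rewrite le_eqVlt; apply/orP; left; apply/eqP; ring.
by rewrite ler_pM2l ?mulr_gt0 // in h3.
Qed.

End Majorant.

(** * Power sums of the roots and the equation at infinity *)

Section Reciprocal.
Variable F : numFieldType.
Implicit Types (p q f g B w : {poly F}) (rs : seq F).

Lemma poly_eq_punctured f g : (forall x, x != 0 -> f.[x] = g.[x]) -> f = g.
Proof.
move=> h; apply/eqP; rewrite -subr_eq0; apply/negP => /negP fg0.
pose s := [seq i.+1%:R : F | i <- iota 0 (size (f - g))].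
suff : (size s < size (f - g)%R)%N by rewrite size_map size_iota ltnn.
apply: max_poly_roots => //.
  apply/allP => _ /mapP[i _ ->]; have i0 : i.+1%:R != 0 :> F by rewrite pnatr_eq0.
  by rewrite rootE hornerD hornerN h // subrr.
rewrite map_inj_uniq ?iota_uniq // => i j /eqP.
by rewrite eqr_nat eqSS => /eqP.
Qed.

(** [recip n p] is [x^n p(1/x)], the expansion at infinity of a polynomial of
    degree at most [n]. *)
Definition recip n p : {poly F} := \poly_(s < n.+1) p`_(n - s).

Lemma horner_recip n p x : (size p <= n.+1)%N -> x != 0 ->
  (recip n p).[x] = x ^+ n * p.[x^-1].
Proof.
move=> sp x0; rewrite horner_poly (horner_coef_wide _ sp) mulr_sumr.
rewrite (reindex_inj rev_ord_inj) /=; apply: eq_bigr => s _.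
have sn : (s <= n)%N by rewrite -ltnS.
rewrite subSS subKn // mulrCA exprVn; congr (_ * _).
by rewrite exprB ?unitfE.
Qed.

Definition recip_prod rs : {poly F} := \prod_(z <- rs) (1 - z *: 'X).

Lemma recip_prodE (c : F) rs :
  recip (size rs) (c *: \prod_(z <- rs) ('X - z%:P)) = c *: recip_prod rs.
Proof.
apply: poly_eq_punctured => x x0; rewrite horner_recip //; last first.
  by rewrite (leq_trans (size_scale_leq _ _)) // size_prod_XsubC.
rewrite !hornerZ mulrCA; congr (_ * _).
rewrite /recip_prod; elim: rs => [|z rs IH].
  by rewrite !big_nil !hornerC mulr1.
rewrite !big_cons !hornerM -IH hornerXsubC hornerD hornerN hornerZ hornerX hornerC [size _]/= exprS.
by field.
Qed.

Definition psum rs r : F := \sum_(z <- rs) z ^+ r.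

(** Newton's identities: for [B = prod (1 - z x)], both [n B - x B'] and
    [(sum_r psum_r x^r) B] are the sum over the roots [z] of [B / (1 - z x)].
    Truncating the series at order [N] changes the product by a multiple of
    [x^N]. *)
Lemma newton_trunc N rs : exists h : {poly F},
  (\poly_(r < N) psum rs r) * recip_prod rs =
  (size rs)%:R *: recip_prod rs - 'X * (recip_prod rs)^`() + 'X^N * h.
Proof.
elim: rs => [|z rs [h IH]].
  exists 0; rewrite /recip_prod big_nil mulr1 scale0r derivC !mulr0 subr0 addr0.
  by apply/polyP => i; rewrite coef_poly coef0 /psum big_nil if_same.
set B := recip_prod rs in IH *.
have -> : recip_prod (z :: rs) = (1 - z *: 'X) * B by rewrite /recip_prod big_cons.
have -> : \poly_(r < N) psum (z :: rs) r =
    \poly_(r < N) z ^+ r + \poly_(r < N) psum rs r.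
  apply/polyP => i; rewrite coefD !coef_poly; case: ifP => _; last by rewrite addr0.
  by rewrite /psum big_cons.
have G : \poly_(r < N) z ^+ r * (1 - z *: 'X) = 1 - (z ^+ N) *: 'X^N.
  elim: (N) => [|m IHm].
    by rewrite poly_def big_ord0 mul0r expr0 expr0 scale1r subrr.
  rewrite poly_def big_ord_recr /= -poly_def mulrDl IHm -!mul_polyC !exprS polyCM.
  ring.
exists ((1 - z *: 'X) * h - z ^+ N *: B).
rewrite mulrDl mulrA G mulrCA IH derivM derivB derivC derivZ derivX /= -natr1.
rewrite -!mul_polyC polyCD polyC1; ring.
Qed.

(** For [B = recip n p] and [e = 1/n], this is [e^i z^(i-n) p^(i)(z)] written
    in the variable [x = 1/z]. *)
Fixpoint euler_ff (e : F) B i : {poly F} :=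
  if i is i'.+1 then
    euler_ff e B i' - (i'%:R * e) *: euler_ff e B i' - e *: ('X * (euler_ff e B i')^`())
  else B.

(** Multiplication by [B] intertwines [w + e z d/dz], acting on a series, with
    [1 - e x d/dx], acting on its product with [B]: this is the Leibniz rule
    together with the equation satisfied by [w]. *)
Lemma riccati_mul e N w B (h : {poly F}) :
  w * B = B - e *: ('X * B^`()) + 'X^N * h ->
  forall i, exists h' : {poly F}, riccati w e i * B = euler_ff e B i + 'X^N * h'.
Proof.
move=> hw; elim=> [|i [h' IH]]; first by exists 0; rewrite mul1r mulr0 addr0.
set P := riccati w e i in IH; set E := euler_ff e B i in IH.
have dP : 'X * (P^`() * B) = 'X * E^`() + 'X * ('X^N * h')^`() - 'X * (P * B^`()).
  by rewrite -mulrDr -derivD -IH derivM mulrDr addrK.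
have [g hg] : exists g : {poly F}, 'X * ('X^N * h')^`() = 'X^N * g.
  exists (N%:R *: h' + 'X * h'^`()); rewrite derivM derivXn.
  case: (N) => [|m]; first by rewrite mulr0n mul0r scale0r !add0r; ring.
  by rewrite -mul_polyC /= exprS -[_ *+ m.+1]mulr_natl rmorph_nat; ring.
exists (P * h + h' - (i%:R * e) *: h' - e *: g).
rewrite /= -/P -/E.
have -> : (w * P - (i%:R * e) *: P - e *: ('X * P^`())) * B =
    P * (w * B) - (i%:R * e) *: (P * B) - e *: ('X * (P^`() * B)).
  by rewrite -!mul_polyC; ring.
rewrite hw dP hg.
have -> : P * (B - e *: ('X * B^`()) + 'X^N * h) =
    P * B - e *: ('X * (P * B^`())) + 'X^N * (P * h) by rewrite -!mul_polyC; ring.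
by rewrite IH -!mul_polyC; ring.
Qed.

Lemma coef_euler_ff n p i s : (0 < n)%N -> (s <= n)%N ->
  (euler_ff n%:R^-1 (recip n p) i)`_s * n%:R ^+ i = p`_(n - s) *+ (n - s) ^_ i.
Proof.
move=> n0 sn; have n0' : n%:R != 0 :> F by rewrite pnatr_eq0 -lt0n.
elim: i => [|i IH]; first by rewrite /= coef_poly ltnS sn mulr1 ffactn0.
rewrite /= !coefB !coefZ coefXM coef_deriv ffactnSr mulrnA -IH exprS.
set x := (euler_ff _ _ _)`_s.
have -> : (if s == 0 then 0 else (euler_ff n%:R^-1 (recip n p) i)`_s.-1.+1 *+ s.-1.+1)
   = s%:R * x by case: (s) @x => [|s'] /=; rewrite ?mul0r // mulr_natl.
have -> : x * n%:R ^+ i *+ (n - s - i) = x * n%:R ^+ i * (n%:R - s%:R - i%:R).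
  rewrite -mulr_natr; case: (leqP i (n - s)) => hi; first by rewrite !natrB.
  by rewrite IH ffact_small // mulr0n !mul0r.
by field.
Qed.

Lemma recip_derivn n p i : (0 < n)%N -> (i <= n)%N ->
  n%:R ^+ i *: euler_ff n%:R^-1 (recip n p) i = recip (n - i) p^`(i).
Proof.
move=> n0 lein; apply/polyP => s; rewrite coefZ coef_poly coef_derivn mulrC.
case: (leqP s n) => sn; last first.
  rewrite ifF; last by apply/negbTE; rewrite -leqNgt; lia.
  suff -> : (euler_ff n%:R^-1 (recip n p) i)`_s = 0 by rewrite mul0r.
  elim: i {lein} => [|i IH] /=; first by rewrite coef_poly ltnS leqNgt sn.
  by rewrite !coefB !coefZ coefXM coef_deriv; case: (s) sn IH => // m _ /= ->;
    rewrite mul0rn !mulr0 !subr0.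
rewrite coef_euler_ff //; case: ltnP => hs.
  by rewrite (_ : (i + (n - i - s) = n - s)%N) //; lia.
by rewrite ffact_small ?mulr0n //; lia.
Qed.

End Reciprocal.

Section PencilAtInfinity.
Variable R : realType.
Variables (k : nat) (Q : 'I_k.+1 -> {poly R[i]}).
Hypothesis hQ : pencil_coefs Q.

Lemma recip_pencil n (lambda : R[i]) (p : {poly R[i]}) : (k <= n)%N -> (size p <= n.+1)%N ->
  pencil Q lambda p = 0 ->
  \sum_(i < k.+1) lambda ^+ (k - i) *: (recip i (Q i) * recip (n - i) p^`(i)) = 0.
Proof.
move=> kn sp hp; apply: poly_eq_punctured => x x0; rewrite horner0.
have sd (i : 'I_k.+1) : (size p^`(i) <= (n - i).+1)%N.
  apply/leq_sizeP => j hj; rewrite coef_derivn nth_default ?mul0rn //.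
  by apply: leq_trans sp _; have := ltn_ord i; lia.
rewrite horner_sum -[RHS](mulr0 (x ^+ n)) -[in RHS](horner0 x^-1) -hp /pencil.
rewrite horner_sum mulr_sumr; apply: eq_bigr => i _.
rewrite !hornerZ !hornerM !horner_recip // mulrACA -exprD subnKC.
  exact: mulrCA.
by apply: leq_trans kn; rewrite -ltnS.
Qed.

(** The eigenvalue equation read at infinity is [S B = 0] modulo [x^N], where
    [S] is the displayed sum, and [B] is invertible modulo [x^N] since its
    constant term is the leading coefficient of [p]. *)
Lemma riccati_pencil n N (lambda : R[i]) (rs : seq R[i]) (p : {poly R[i]})
    (e := n%:R^-1 : R[i]) : (0 < n)%N -> (k <= n)%N ->
  lambda != 0 -> size rs = n -> p != 0 ->
  p = lead_coef p *: \prod_(z <- rs) ('X - z%:P) ->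
  pencil Q lambda p = 0 ->
  forall r, (r < N)%N ->
  (\sum_(i < k.+1) ((n%:R / lambda) ^+ i *: recip i (Q i)) *
     riccati (e *: \poly_(r < N) psum rs r) e i)`_r = 0.
Proof.
move=> n0 kn l0 srs p0 pE hp r rN.
have n0' : n%:R != 0 :> R[i] by rewrite pnatr_eq0 -lt0n.
pose B := recip n p.
have BE : B = lead_coef p *: recip_prod rs by rewrite /B {1}pE -srs recip_prodE.
have sp : size p = n.+1.
  by rewrite pE size_scale ?lead_coef_eq0 // size_prod_XsubC srs.
have [h hN] := newton_trunc N rs.
set w := e *: _.
have wB : w * B = B - e *: ('X * B^`()) + 'X^N * ((e * lead_coef p) *: h).
  rewrite BE /w -scalerAl -scalerAr hN srs derivZ /e.
  have en : e%:P * n%:R%:P = 1 :> {poly R[i]} by rewrite -polyCM mulVf.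
  rewrite -!mul_polyC polyCM -[in RHS](mul1r ((lead_coef p)%:P * _)) -[in RHS]en.
  ring.
have hE : \sum_(i < k.+1) ((n%:R / lambda) ^+ i *: recip i (Q i)) * euler_ff e B i = 0.
  have /eqP := recip_pencil kn (eq_leq sp) hp.
  have -> : \sum_(i < k.+1) lambda ^+ (k - i) *: (recip i (Q i) * recip (n - i) p^`(i)) =
    lambda ^+ k *: \sum_(i < k.+1) ((n%:R / lambda) ^+ i *: recip i (Q i)) * euler_ff e B i.
    rewrite scaler_sumr; apply: eq_bigr => i _.
    have ik : (i <= k)%N by rewrite -ltnS.
    rewrite -recip_derivn ?(leq_trans ik) //.
    rewrite -scalerAl -scalerAr !scalerA; congr (_ *: _).
    by rewrite exprB ?unitfE // expr_div_n; field; rewrite expf_neq0.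
  by rewrite scaler_eq0 expf_eq0 (negbTE l0) andbF /= => /eqP.
have := riccati_mul wB => hr.
set S := \sum_i _.
have [g hg] : exists g, S * B = 'X^N * g.
  have : forall i : 'I_k.+1, exists h', riccati w e i * B = euler_ff e B i + 'X^N * h'.
    by move=> i; exact: hr.
  case/boolp.choice => H hH.
  exists (\sum_(i < k.+1) ((n%:R / lambda) ^+ i *: recip i (Q i)) * H i).
  transitivity (\sum_(i < k.+1) ((n%:R / lambda) ^+ i *: recip i (Q i)) * euler_ff e B i
    + 'X^N * \sum_(i < k.+1) ((n%:R / lambda) ^+ i *: recip i (Q i)) * H i).
    rewrite /S mulr_suml mulr_sumr -big_split /=; apply: eq_bigr => i _.
    by rewrite -mulrA hH; ring.
  by rewrite hE add0r.
have cop : coprimep 'X^N B.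
  rewrite coprimep_expl // coprimep_sym -[X in coprimep _ X]subr0 -polyC0 coprimep_XsubC.
  by rewrite rootE horner_coef0 coef_poly subn0 /= -[n]/(n.+1.-1) -sp lead_coef_eq0.
have : 'X^N %| S by rewrite -(Gauss_dvdpl _ cop) hg dvdp_mulr.
by case/dvdpP => g' ->; rewrite coefMXn rN.
Qed.

End PencilAtInfinity.

Section PowerSums.
Variable R : realType.

Lemma bernoulli_ge (x : R) n : 0 <= x -> 1 + n%:R * x <= (1 + x) ^+ n.
Proof.
move=> x0; elim: n => [|n IH]; first by rewrite mul0r addr0 expr0.
rewrite exprS -natr1; apply: le_trans (ler_wpM2l _ IH); last by lra.
have : 0 <= n%:R * (x * x) by rewrite !mulr_ge0.
lra.
Qed.

Lemma geometric_le (a b c D : R) : 0 < b -> 0 < c ->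
  (forall n, c * a ^+ n <= D * b ^+ n) -> a <= b.
Proof.
move=> b0 c0 h; rewrite leNgt; apply/negP => ba.
pose x := a / b - 1.
have x0 : 0 < x by rewrite subr_gt0 ltr_pdivlMr // mul1r.
have hx n : c * (n%:R * x) <= D.
  have hn : c * (1 + x) ^+ n <= D.
    rewrite /x addrC subrK expr_div_n mulrA ler_pdivrMr ?exprn_gt0 //.
  apply: le_trans hn; rewrite ler_wpM2l ?(ltW c0) //.
  by apply: le_trans (bernoulli_ge n (ltW x0)); rewrite lerDr.
have cx : 0 < c * x by rewrite mulr_gt0.
pose n := (Num.truncn `|D / (c * x)|).+1.
have : `|D / (c * x)| < n%:R by exact: truncnS_gt.
move=> /(le_lt_trans (ler_norm _)); rewrite ltr_pdivrMr // => hD.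
by have := hx n; rewrite mulrCA leNgt hD.
Qed.

(** Let [f] be the polynomial whose roots are the elements of [rs] other than
    [z0].  The combination of the [psum rs (j + n)] with the coefficients of [f]
    retains only the contribution of [z0], a nonzero multiple of [z0^n], while
    the hypothesis bounds it by a multiple of [M^n]. *)
Lemma psum_bound_roots (rs : seq R[i]) (A M : R) : 0 < M ->
  (forall r, nm (psum rs r) <= A * M ^+ r) ->
  forall z, z \in rs -> nm z <= M.
Proof.
move=> M0 hA z0 z0rs.
pose f : {poly R[i]} := \prod_(z <- rs | z != z0) ('X - z%:P).
have f0 : f.[z0] != 0.
  rewrite /f horner_prod prodf_seq_neq0; apply/allP => z zrs; apply/implyP => zz0.
  by rewrite hornerXsubC subr_eq0 eq_sym.
have sE n : \sum_(z <- rs) f.[z] * z ^+ n = (count_mem z0 rs)%:R * (f.[z0] * z0 ^+ n).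
  rewrite (bigID (pred1 z0)) /= [X in _ + X]big_seq_cond [X in _ + X]big1 ?addr0.
    rewrite (eq_bigr (fun=> f.[z0] * z0 ^+ n)); last by move=> z /eqP ->.
    by rewrite big_const_seq iter_addr_0 mulr_natl.
  move=> z /andP[zrs zz0]; suff /eqP -> : f.[z] == 0 by rewrite mul0r.
  rewrite /f horner_prod prodf_seq_eq0; apply/hasP; exists z => //=.
  by rewrite zz0 hornerXsubC subrr eqxx.
apply: (@geometric_le _ _ (nm ((count_mem z0 rs)%:R * f.[z0]))
  (\sum_(j < size f) nm f`_j * (A * M ^+ j))) => //.
  rewrite nm_gt0 mulf_neq0 // pnatr_eq0 -lt0n -has_count has_pred1 //.
move=> n; rewrite -nmX -nmM -mulrA -sE.
have -> : \sum_(z <- rs) f.[z] * z ^+ n = \sum_(j < size f) f`_j * psum rs (j + n).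
  rewrite /psum; under [RHS]eq_bigr => j _ do rewrite mulr_sumr.
  rewrite exchange_big /=; apply: eq_bigr => z _.
  by rewrite horner_coef mulr_suml; apply: eq_bigr => j _; rewrite exprD mulrA.
apply: le_trans (nm_sum _ _ _) _; rewrite mulr_suml; apply: ler_sum => j _.
by rewrite nmM -mulrA ler_wpM2l ?nm_ge0 // -mulrA -exprD hA.
Qed.

End PowerSums.

(** * Triangular action on monomials and labelling of the eigenvalues *)

Section Triangular.
Variable R : realType.
Variables (k : nat) (Q : 'I_k.+1 -> {poly R[i]}).
Hypothesis hQ : pencil_coefs Q.
Implicit Types (lambda : R[i]) (p f : {poly R[i]}).

Definition pencil_diag lambda m : R[i] :=
  \sum_(i < k.+1) lambda ^+ (k - i) * ((Q i)`_i * (m ^_ i)%:R).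

(** As the degree of [Q i] is at most [i], the operator does not raise degrees,
    and only the top coefficients of the [Q i] act on the top coefficient of [p]. *)
Lemma coef_pencil lambda p l : (size p <= l.+1)%N ->
  (pencil Q lambda p)`_l = pencil_diag lambda l * p`_l.
Proof.
move=> sp; rewrite /pencil coef_sum /pencil_diag mulr_suml.
apply: eq_bigr => i _; rewrite coefZ -!mulrA; congr (_ * _).
have p0 j : (l < j)%N -> p`_j = 0 by move=> lj; rewrite nth_default // (leq_trans sp).
have Q0 j : (i < j)%N -> (Q i)`_j = 0.
  by move=> ij; rewrite nth_default // (leq_trans (hQ i)).
rewrite coefM mulr_natl; case: (ltnP l i) => [li|il].
  rewrite ffact_small // mulr0n mulr0 big1 // => j _.
  by rewrite coef_derivn p0 ?mul0rn ?mulr0 //; have := ltn_ord j; lia.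
have li : (i < l.+1)%N by rewrite ltnS.
rewrite (bigD1 (Ordinal li)) //= coef_derivn subnKC // big1 ?addr0 // => j.
rewrite -val_eqE /= => ji; case: (ltngtP i j) => [ij|jli|e].
- by rewrite Q0 // mul0r.
- by rewrite coef_derivn p0 ?mul0rn ?mulr0 //; have := ltn_ord j; lia.
- by rewrite e eqxx in ji.
Qed.

Lemma pencilD lambda p f : pencil Q lambda (p + f) = pencil Q lambda p + pencil Q lambda f.
Proof.
rewrite /pencil -big_split; apply: eq_bigr => i _ /=.
by rewrite derivnD mulrDr scalerDr.
Qed.

Lemma size_pencil lambda p m : (size p <= m)%N -> (size (pencil Q lambda p) <= m)%N.
Proof.
move=> sp; apply/leq_sizeP => j mj.
rewrite coef_pencil; first by rewrite [p`__]nth_default ?mulr0 // (leq_trans sp).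
by rewrite (leq_trans sp) // (leq_trans mj).
Qed.

Lemma pencil_solve lambda m : (forall l, (l < m)%N -> pencil_diag lambda l != 0) ->
  forall f, (size f <= m)%N ->
  exists2 g : {poly R[i]}, (size g <= m)%N & pencil Q lambda g = f.
Proof.
elim: m => [|m IH] hd f sf.
  exists 0; rewrite ?size_poly0 //; move: sf; rewrite size_poly_leq0 => /eqP ->.
  by apply/eqP; rewrite -size_poly_leq0 size_pencil // size_poly0.
(* Kill the coefficient of index [m] with a multiple of ['X^m]. *)
pose c := f`_m / pencil_diag lambda m.
have sX : (size (c *: 'X^m) <= m.+1)%N.
  by rewrite (leq_trans (size_scale_leq _ _)) // size_polyXn.
have [||g sg hg] := IH _ (f - pencil Q lambda (c *: 'X^m)).
- by move=> l lm; apply: hd; rewrite ltnS ltnW.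
- apply/leq_sizeP => j; rewrite leq_eqVlt => /orP[/eqP <-|mj].
    rewrite coefB coef_pencil // coefZ coefXn eqxx mulr1 /c mulrC divfK ?subrr //.
    exact: hd.
  rewrite nth_default // (leq_trans (size_polyD _ _)) // geq_max size_polyN.
  by rewrite (leq_trans sf) // (leq_trans (size_pencil _ sX)).
exists (c *: 'X^m + g); last by rewrite pencilD hg addrC subrK.
by rewrite (leq_trans (size_polyD _ _)) // geq_max sX (leq_trans sg).
Qed.

(** The image of ['X^n] has degree less than [n], hence it is also the image
    of a polynomial of degree less than [n]. *)
Lemma eigenpolynomial_deg_exists lambda n : pencil_diag lambda n = 0 ->
  (forall l, (l < n)%N -> pencil_diag lambda l != 0) ->
  exists p, eigenpolynomial_deg Q n lambda p.
Proof.
move=> hn hl.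
have [|g sg hg] := pencil_solve hl (f := - pencil Q lambda 'X^n).
  rewrite size_polyN; apply/leq_sizeP => j nj.
  rewrite coef_pencil ?size_polyXn ?ltnS // coefXn; move: nj; rewrite leq_eqVlt.
  by case/orP => [/eqP <-|nj]; rewrite ?hn ?mul0r // gtn_eqF // mulr0.
have sp : size ('X^n + g) = n.+1 by rewrite size_polyDl size_polyXn.
exists ('X^n + g); split=> //; split; last by rewrite pencilD hg subrr.
by rewrite -size_poly_eq0 sp.
Qed.

Lemma eigenpolynomial_deg_diag lambda n p : eigenpolynomial_deg Q n lambda p ->
  pencil_diag lambda n = 0.
Proof.
case=> -[p0 hp] sp; have /eqP := coef_pencil lambda (eq_leq sp).
rewrite hp coef0 eq_sym mulf_eq0 => /orP[/eqP //|].
by rewrite -[n]/(n.+1.-1) -sp lead_coef_eq0 (negbTE p0).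
Qed.

(** The diagonal entry at [z^n] in the variable [t = lambda / n], divided by
    [n^k]; its limit is the characteristic polynomial. *)
Definition char_poly_deg n : {poly R[i]} :=
  \sum_(i < k.+1) ((Q i)`_i * sffact n%:R^-1 i) *: 'X^(k - i).

Lemma horner_char_poly_deg n (t : R[i]) : (char_poly_deg n).[t] =
  \sum_(i < k.+1) (Q i)`_i * sffact n%:R^-1 i * t ^+ (k - i).
Proof.
by rewrite horner_sum; apply: eq_bigr => i _; rewrite hornerZ hornerXn.
Qed.

Lemma pencil_diagE n (t : R[i]) : (0 < n)%N ->
  pencil_diag (n%:R * t) n = n%:R ^+ k * (char_poly_deg n).[t].
Proof.
move=> n0; have n0' : n%:R != 0 :> R[i] by rewrite pnatr_eq0 -lt0n.
rewrite horner_char_poly_deg mulr_sumr; apply: eq_bigr => i _.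
rewrite -sffactE // exprMn.
have -> : (n%:R : R[i]) ^+ k = n%:R ^+ (k - i) * n%:R ^+ i.
  by rewrite -exprD subnK // -ltnS.
ring.
Qed.

(** The diagonal entry at [z^n] vanishes, so the one at [z^(n-r)] is given by
    a divided difference. *)
Lemma pencil_diag_lower n r (t : R[i]) (e := n%:R^-1 : R[i]) :
  (0 < n)%N -> (r <= n)%N -> t != 0 -> root (char_poly_deg n) t ->
  pencil_diag (n%:R * t) (n - r) = - ((n%:R * t) ^+ k * (r%:R * e) *
    \sum_(i < k.+1) (Q i)`_i * t^-1 ^+ i * sffact_dd e (r%:R * e) i).
Proof.
move=> n0 rn t0 /eqP; rewrite horner_char_poly_deg => ht.
have n0' : n%:R != 0 :> R[i] by rewrite pnatr_eq0 -lt0n.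
(* The equation for [t], divided by [t^k]. *)
have ht' : \sum_(i < k.+1) (Q i)`_i * t^-1 ^+ i * sffact e i = 0.
  apply: (mulfI (expf_neq0 k t0)); rewrite mulr0 -[RHS]ht mulr_sumr.
  apply: eq_bigr => i _; have ik : (i <= k)%N by rewrite -ltnS.
  rewrite exprB ?unitfE // exprVn.
  by field; rewrite expf_neq0.
rewrite -mulrA mulr_sumr.
have -> : \sum_(i < k.+1) r%:R * e * ((Q i)`_i * t^-1 ^+ i * sffact_dd e (r%:R * e) i)
  = - \sum_(i < k.+1) (Q i)`_i * t^-1 ^+ i * (((n - r) ^_ i)%:R / n%:R ^+ i).
  rewrite -[RHS]add0r -[X in _ = X + _]ht' -sumrB; apply: eq_bigr => i _.
  by rewrite mulrCA (sffact_ddE _ n0' rn) -/e; ring.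
rewrite mulrN opprK mulr_sumr; apply: eq_bigr => i _.
have ik : (i <= k)%N by rewrite -ltnS.
rewrite exprB ?unitfE ?mulf_neq0 // !exprMn exprVn.
by field; rewrite !expf_neq0.
Qed.

End Triangular.

Section Labelling.
Variable R : realType.
Variables (k : nat) (Q : 'I_k.+1 -> {poly R[i]}) (alpha : 'I_k -> R[i]).
Hypothesis hQ : pencil_coefs Q.
Hypothesis hgen : general_type Q.
Hypothesis halpha : enumerates_char_roots Q alpha.

Lemma diag_max_neq0 : (Q ord_max)`_(@ord_max k) != 0.
Proof.
have [sQ _] := hgen.
by rewrite -[nat_of_ord _]/(k.+1.-1) -sQ lead_coef_eq0 -size_poly_eq0 sQ.
Qed.

Lemma horner_char_poly_pencil (t : R[i]) : (char_poly_pencil Q).[t] =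
  \sum_(i < k.+1) (Q i)`_i * t ^+ (k - i).
Proof.
by rewrite horner_sum; apply: eq_bigr => i _; rewrite hornerZ hornerXn.
Qed.

Lemma coef_rev_sum (a : 'I_k.+1 -> R[i]) (j : 'I_k.+1) :
  (\sum_(i < k.+1) a i *: 'X^(k - i))`_(k - j) = a j.
Proof.
rewrite coef_sum (bigD1 j) //= coefZ coefXn eqxx mulr1 big1 ?addr0 // => i ij.
rewrite coefZ coefXn; case: eqP => [e|]; last by rewrite mulr0.
case/eqP: ij; apply/val_inj => /=; have := ltn_ord i; have := ltn_ord j; lia.
Qed.

Lemma size_rev_sum (a : 'I_k.+1 -> R[i]) :
  (size (\sum_(i < k.+1) a i *: 'X^(k - i))%R <= k.+1)%N.
Proof.
apply/leq_sizeP => j kj; rewrite coef_sum big1 // => i _.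
by rewrite coefZ coefXn gtn_eqF ?mulr0 // (leq_trans _ kj) // ltnS leq_subr.
Qed.

Lemma alpha_neq0 j : alpha j != 0.
Proof.
apply/eqP => aj; have [_ /(_ j)] := halpha.
rewrite aj rootE horner_coef0 -(subnn k) -[X in (k - X)%N]/(nat_of_ord (@ord_max k)).
by rewrite /char_poly_pencil coef_rev_sum (negbTE diag_max_neq0).
Qed.

Lemma diag0_neq0 : (Q ord0)`_0 != 0.
Proof.
have [ainj ar] := halpha.
have c0 : char_poly_pencil Q != 0.
  apply/eqP => h; have := coef_rev_sum (fun i => (Q i)`_i) ord_max.
  rewrite -/(char_poly_pencil Q) h coef0 => /esym/eqP.
  by rewrite (negbTE diag_max_neq0).
have h : (k < size (char_poly_pencil Q))%N.
  rewrite -[k in (k < _)%N](card_ord k) cardE -(size_map alpha).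
  apply: max_poly_roots => //; last by rewrite map_inj_uniq // enum_uniq.
  by apply/allP => _ /mapP[j _ ->].
have s : size (char_poly_pencil Q) = k.+1.
  by apply/eqP; rewrite eqn_leq h size_rev_sum.
have := coef_rev_sum (fun i => (Q i)`_i) ord0.
rewrite -/(char_poly_pencil Q) subn0 => <-.
by move: c0; rewrite -lead_coef_eq0 lead_coefE s.
Qed.

(** The [k] distinct inverses are roots of the reversed characteristic
    polynomial, which has degree [k]. *)
Lemma reciprocal_factor : \sum_(i < k.+1) (Q i)`_i *: 'X^i =
  (Q ord_max)`_(@ord_max k) *: \prod_(j < k) ('X - ((alpha j)^-1)%:P).
Proof.
have [ainj ar] := halpha.
pose psi := \sum_(i < k.+1) (Q i)`_i *: 'X^i.
have psiE : psi = \poly_(i < k.+1) (Q (inord i))`_i.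
  by rewrite poly_def; apply: eq_bigr => i _; rewrite inord_val.
have psik : psi`_k = (Q ord_max)`_(@ord_max k).
  by rewrite psiE coef_poly ltnSn; congr ((Q _)`__); apply/val_inj; rewrite /= inordK.
have spsi : size psi = k.+1.
  rewrite psiE size_poly_eq //; have := diag_max_neq0.
  by rewrite -psik psiE coef_poly ltnSn.
have rpsi j : root psi (alpha j)^-1.
  rewrite rootE; have := ar j; rewrite rootE horner_char_poly_pencil => /eqP h.
  have a0 := alpha_neq0 j.
  suff : alpha j ^+ k * psi.[(alpha j)^-1] = 0.
    by move/eqP; rewrite mulf_eq0 expf_eq0 (negbTE a0) andbF.
  rewrite -h horner_sum mulr_sumr; apply: eq_bigr => i _.
  have ik : (i <= k)%N by rewrite -ltnS.
  rewrite hornerZ hornerXn exprB ?unitfE // exprVn.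
  by field; rewrite expf_neq0.
pose rs := [seq (alpha j)^-1 | j <- enum 'I_k].
have srs : size rs = k by rewrite size_map size_enum_ord.
rewrite -/psi (@all_roots_prod_XsubC _ psi rs); last 3 first.
- by rewrite spsi srs.
- by apply/allP => _ /mapP[j _ ->].
- rewrite uniq_rootsE map_inj_uniq ?enum_uniq // => x y /invr_inj; exact: ainj.
by rewrite lead_coefE spsi psik /rs big_map enumT.
Qed.

(** The line condition passes to the inverses of the characteristic roots. *)
Lemma alpha_line (i j : 'I_k) (x : R) : i != j ->
  (alpha i)^-1 <> x%:C * (alpha j)^-1.
Proof.
move=> ij h; have [ainj ar] := halpha; have [_ hl] := hgen.
have ai := alpha_neq0 i; have aj := alpha_neq0 j.
have aij : alpha i != alpha j by apply: contra ij => /eqP/ainj ->.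
apply: (hl _ _ (ar i) (ar j) aij); exists (alpha i) => //; split.
  by exists 1; rewrite mul1r.
exists x; apply: (mulIf (invr_neq0 aj)); rewrite mulfV // mulrAC -h.
by rewrite mulVf.
Qed.

(** The product of the [k] distances from [alpha j] to the roots is at least
    the [k]-th power of the smallest one. *)
Lemma closest_root n (j : 'I_k) : exists t : R[i], root (char_poly_deg Q n) t /\
  nm (Q ord0)`_0 * nm (alpha j - t) ^+ k <= nm (char_poly_deg Q n).[alpha j].
Proof.
have lc : (char_poly_deg Q n)`_k = (Q ord0)`_0.
  rewrite -[k in _`_k]subn0 -[X in (_ - X)%N]/(nat_of_ord (@ord0 k)).
  by rewrite /char_poly_deg coef_rev_sum /= mulr1.
have sc : size (char_poly_deg Q n) = k.+1.
  apply/eqP; rewrite eqn_leq size_rev_sum ltnNge; apply/negP => h.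
  by have := diag0_neq0; rewrite -lc nth_default // eqxx.
have [rs hrs] := closed_field_poly_normal (char_poly_deg Q n).
rewrite lead_coefE sc lc in hrs.
have srs : size rs = k.
  by have := sc; rewrite hrs size_scale ?diag0_neq0 // size_prod_XsubC => -[].
pose F (l : 'I_k) := nm (alpha j - rs`_l).
have [l _ hl] := @Order.TotalTheory.arg_minP _ R _ j xpredT F isT.
exists rs`_l; split.
  rewrite hrs rootZ ?diag0_neq0 // root_prod_XsubC mem_nth // srs //.
rewrite hrs hornerZ nmM ler_wpM2l ?nm_ge0 // horner_prod nm_prod.
rewrite (big_nth 0) srs big_mkord -[k in _ ^+ k]card_ord -prodr_const.
apply: ler_prod => m _; rewrite nm_ge0 hornerXsubC /=; exact: hl.
Qed.

Lemma char_poly_deg_at_root : exists2 D : R, 0 <= D &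
  forall n j, (0 < n)%N -> nm (char_poly_deg Q n).[alpha j] <= D / n%:R.
Proof.
have : forall j : 'I_k, exists D : R, 0 <= D /\
    forall n, (0 < n)%N -> nm (char_poly_deg Q n).[alpha j] <= D / n%:R.
  move=> j.
  have : forall i : 'I_k.+1, exists D : R, 0 <= D /\ forall e : R[i], nm e <= 1 ->
      nm ((Q i)`_i * (sffact e i - 1) * alpha j ^+ (k - i)) <= D * nm e.
    move=> i; have [C C0 hC] := sffact_bound R i.
    exists (nm (Q i)`_i * C * nm (alpha j ^+ (k - i))); split=> [|e he].
      by rewrite !mulr_ge0 ?nm_ge0.
    have [_ h] := hC e he.
    by rewrite !nmM [leRHS]mulrAC ler_wpM2r ?nm_ge0 // -mulrA ler_wpM2l ?nm_ge0.
  case/boolp.choice => D hD.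
  exists (\sum_i D i); split=> [|n n0].
    by apply: sumr_ge0 => i _; case: (hD i).
  have [_ /(_ j)] := halpha; rewrite rootE horner_char_poly_pencil => /eqP h0.
  rewrite -[_.[_]]subr0 -[X in _ - X]h0 horner_char_poly_deg -sumrB.
  apply: le_trans (nm_sum _ _ _) _; rewrite mulr_suml; apply: ler_sum => i _.
  have [_ h] := hD i.
  have -> : (Q i)`_i * sffact n%:R^-1 i * alpha j ^+ (k - i) - (Q i)`_i * alpha j ^+ (k - i)
    = (Q i)`_i * (sffact n%:R^-1 i - 1) * alpha j ^+ (k - i) by ring.
  have hn : nm (n%:R^-1 : R[i]) = n%:R^-1 by rewrite nmV nm_nat.
  by rewrite -hn; apply: h; rewrite hn invf_le1 ?ltr0n // ler1n.
case/boolp.choice => D hD.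
exists (\sum_j D j) => [|n j n0]; first by apply: sumr_ge0 => i _; case: (hD i).
have [_ h] := hD j; apply: le_trans (h n n0) _.
rewrite ler_wpM2r ?invr_ge0 // (bigD1 j) //= lerDl.
by apply: sumr_ge0 => i _; case: (hD i).
Qed.

Lemma eventually_large (x : R) : exists N : nat, forall n, (N <= n)%N -> x < n%:R.
Proof.
exists (Num.truncn `|x|).+1 => n hn.
apply: le_lt_trans (ler_norm _) _; apply: lt_le_trans (truncnS_gt _) _.
by rewrite ler_nat.
Qed.

Lemma root_labelling : exists t : nat -> 'I_k -> R[i],
  (forall n j, root (char_poly_deg Q n) (t n j)) /\
  (forall eps : R, 0 < eps -> exists N : nat, forall n j, (N <= n)%N ->
     nm (alpha j - t n j) <= eps).
Proof.
have : forall nj : nat * 'I_k, exists t : R[i], root (char_poly_deg Q nj.1) t /\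
  nm (Q ord0)`_0 * nm (alpha nj.2 - t) ^+ k <= nm (char_poly_deg Q nj.1).[alpha nj.2].
  by case=> n j; exact: closest_root.
case/boolp.choice => t ht; exists (fun n j => t (n, j)); split=> [n j|eps e0].
  by have [] := ht (n, j).
have [D D0 hD] := char_poly_deg_at_root.
have q0 : 0 < nm (Q ord0)`_0 by rewrite nm_gt0 diag0_neq0.
have [N hN] := eventually_large (D / (nm (Q ord0)`_0 * eps ^+ k)).
exists N.+1 => n j Nn; rewrite leNgt; apply/negP => h.
have [_ /= h1] := ht (n, j).
have n0 : (0 < n)%N by apply: leq_trans Nn.
have := hN n (ltnW Nn); rewrite ltr_pdivrMr ?mulr_gt0 ?exprn_gt0 //.
apply/negP; rewrite -leNgt.
have n0' : 0 < n%:R :> R by rewrite ltr0n.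
rewrite -ler_pdivlMl // [leRHS]mulrC; apply: le_trans (hD n j n0).
apply: le_trans h1; rewrite ler_wpM2l ?(ltW q0) //.
by apply: lerXn2r; rewrite ?nnegrE ?nm_ge0 // ltW.
Qed.

End Labelling.

(** * Uniform estimates along the labelled eigenvalues *)

Lemma fin_pos_lower_bound (R : realType) (T : finType) (c : T -> R) :
  (forall x, 0 < c x) -> exists2 m : R, 0 < m & forall x, m <= c x.
Proof.
move=> c0; pose s := \sum_x (c x)^-1.
have s0 : 0 <= s by apply: sumr_ge0 => x _; rewrite invr_ge0 ltW.
have s1 : 0 < 1 + s by rewrite ltr_wpDr.
exists (1 + s)^-1 => [|x]; first by rewrite invr_gt0.
rewrite -[leRHS]invrK lef_pV2 ?posrE ?invr_gt0 //.
rewrite /s (bigD1 x) //= addrCA lerDl addr_ge0 //.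
by apply: sumr_ge0 => y _; rewrite invr_ge0 ltW.
Qed.

Lemma inv_close (R : realType) (a : R[i]) (eta : R) : a != 0 -> 0 < eta ->
  exists2 eps : R, 0 < eps & forall t : R[i], nm (a - t) <= eps ->
    t != 0 /\ nm (t^-1 - a^-1) <= eta.
Proof.
move=> a0 e0; have na : 0 < nm a by rewrite nm_gt0.
exists (Num.min (nm a / 2) (eta * nm a ^+ 2 / 2)) => [|t].
  by rewrite lt_min !divr_gt0 // mulr_gt0 // exprn_gt0.
rewrite le_min => /andP[h1 h2].
have ht : nm a / 2 <= nm t by have := nmD (a - t) t; rewrite subrK; lra.
have nt : 0 < nm t by apply: lt_le_trans ht; rewrite divr_gt0.
have t0 : t != 0 by rewrite -nm_gt0.
split=> //; have -> : t^-1 - a^-1 = (a - t) / (t * a) by field; rewrite ?t0 ?a0.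
rewrite nmM nmV nmM ler_pdivrMr ?mulr_gt0 //; apply: le_trans h2 _.
have -> : eta * nm a ^+ 2 / 2 = eta * (nm a / 2 * nm a) by ring.
by rewrite ler_wpM2l ?(ltW e0) // ler_wpM2r ?(ltW na).
Qed.

Section LabelledEigenvalues.
Variable R : realType.
Variables (k : nat) (Q : 'I_k.+1 -> {poly R[i]}) (alpha : 'I_k -> R[i]).
Hypothesis hQ : pencil_coefs Q.
Hypothesis hgen : general_type Q.
Hypothesis halpha : enumerates_char_roots Q alpha.
Variable t : nat -> 'I_k -> R[i].
Hypothesis t_root : forall n j, root (char_poly_deg Q n) (t n j).
Hypothesis t_lim : forall eps : R, 0 < eps -> exists N : nat,
  forall n j, (N <= n)%N -> nm (alpha j - t n j) <= eps.

Lemma t_eventually_injective : exists N : nat, forall n, (N <= n)%N -> injective (t n).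
Proof.
have [ainj _] := halpha.
(* The value 1 on the diagonal is a positive default. *)
pose d (p : 'I_k * 'I_k) := if p.1 == p.2 then 1 else nm (alpha p.1 - alpha p.2).
have [p|m m0 hm] := @fin_pos_lower_bound R _ d.
  rewrite /d; case: eqVneq => [_ //|ij]; rewrite nm_gt0 subr_eq0.
  by apply: contra ij => /eqP/ainj ->.
have m3 : 0 < m / 3 by rewrite divr_gt0.
have [N hN] := t_lim m3; exists N => n Nn i j tij.
apply/eqP/negP => /negP ij; have := hm (i, j); rewrite /d /= (negbTE ij).
have := hN n i Nn; have := hN n j Nn; rewrite -tij => hj hi.
have := nmB (alpha i - t n i) (alpha j - t n i).
have -> : alpha i - t n i - (alpha j - t n i) = alpha i - alpha j by ring.
lra.
Qed.

Lemma char_poly_deg_roots n (z : R[i]) : injective (t n) ->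
  root (char_poly_deg Q n) z -> exists j, z = t n j.
Proof.
move=> tinj rz; apply: boolp.contrapT => hz.
have c0 : char_poly_deg Q n != 0.
  apply/eqP => h; have := coef_rev_sum (fun i => (Q i)`_i * sffact n%:R^-1 i) ord0.
  rewrite -/(char_poly_deg Q n) h coef0 /= mulr1 => /esym/eqP.
  by rewrite (negbTE (diag0_neq0 hgen halpha)).
have : (size (z :: [seq t n j | j <- enum 'I_k]) < size (char_poly_deg Q n))%N.
  apply: max_poly_roots => //=.
    by rewrite rz /=; apply/allP => _ /mapP[j _ ->].
  rewrite map_inj_uniq // enum_uniq andbT; apply/mapP => -[j _ zj].
  by apply: hz; exists j.
by rewrite /= size_map size_enum_ord ltnNge size_rev_sum.
Qed.

(** [nonresonance] at the points that matter: [e = 1/n], [x = r/n], and [v] the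
    inverse of a labelled root, with constants independent of [j]. *)
Lemma eventually_nonresonant : exists (c V : R) (N : nat),
  [/\ 0 < c, 0 <= V & forall n j, (N <= n)%N ->
    [/\ (0 < n)%N, (k <= n)%N, t n j != 0, nm (t n j)^-1 <= V &
    forall r, (0 < r)%N -> let T := 1 + r%:R * nm (n%:R^-1 : R[i]) in
      c * T ^+ k <= T * nm (\sum_(i < k.+1) (Q i)`_i * (t n j)^-1 ^+ i *
         sffact_dd n%:R^-1 (r%:R * n%:R^-1) i)]].
Proof.
have nr (j : 'I_k) : exists ceta : R * R, [/\ 0 < ceta.1, 0 < ceta.2 &
  forall (e v : R[i]) (x : R), nm e <= ceta.2 -> nm (v - (alpha j)^-1) <= ceta.2 -> 0 < x ->
    ceta.1 * (1 + x) ^+ k <=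
    (1 + x) * nm (\sum_(i < k.+1) (Q i)`_i * v ^+ i * sffact_dd e x%:C i)].
  have [c [eta h]] := nonresonance (diag_max_neq0 hgen) (reciprocal_factor hgen halpha)
    (fun j => invr_neq0 (alpha_neq0 hgen halpha j)) (alpha_line hgen halpha) j.
  by exists (c, eta).
case/boolp.choice: nr => ce hce.
have [j|c c0 hc] := fin_pos_lower_bound (c := fun j => (ce j).1); first by case: (hce j).
have [j|eta eta0 heta] := fin_pos_lower_bound (c := fun j => (ce j).2).
  by case: (hce j).
have ic (j : 'I_k) : exists eps : R, 0 < eps /\ forall z : R[i], nm (alpha j - z) <= eps ->
    z != 0 /\ nm (z^-1 - (alpha j)^-1) <= eta.
  by have [eps e0 h] := inv_close (alpha_neq0 hgen halpha j) eta0; exists eps.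
case/boolp.choice: ic => ep hep.
have [j|eps eps0 heps] := fin_pos_lower_bound (c := ep); first by case: (hep j).
have [N1 hN1] := t_lim eps0.
have [N2 hN2] := eventually_large eta^-1.
exists c, (\sum_j (nm (alpha j)^-1 + eta)), (N1 + N2 + k).+1; split=> //.
  by apply: sumr_ge0 => j _; rewrite addr_ge0 ?nm_ge0 // ltW.
move=> n j hn; have n0 : (0 < n)%N by apply: leq_trans hn.
have [cj0 ej0 hj] := hce j.
have [_ /(_ (t n j)) []] := hep j.
  by apply: le_trans (heps j); apply: hN1; lia.
move=> t0 ht; have nn : nm (n%:R^-1 : R[i]) = n%:R^-1 by rewrite nmV nm_nat.
have n0' : 0 < n%:R :> R by rewrite ltr0n.
split=> //; first by lia.
  apply: (@le_trans _ _ (nm (alpha j)^-1 + eta)).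
    by have := nmD ((t n j)^-1 - (alpha j)^-1) (alpha j)^-1; rewrite subrK; lra.
  by rewrite (bigD1 j) //= lerDl; apply: sumr_ge0 => i _; rewrite addr_ge0 ?nm_ge0 // ltW.
move=> r r0 /=; rewrite nn.
have -> : r%:R * n%:R^-1 = (r%:R / n%:R)%:C :> R[i].
  by rewrite rmorphM /= fmorphV /= !rmorph_nat.
apply: le_trans (hj _ _ _ _ _ _).
- by rewrite ler_wpM2r ?exprn_ge0 // addr_ge0 // divr_ge0.
- rewrite nn (le_trans _ (heta j)) // -[leRHS]invrK lef_pV2 ?posrE ?invr_gt0 //.
  by rewrite ltW // hN2 //; lia.
- exact: le_trans (heta j).
- by rewrite divr_gt0 ?ltr0n.
Qed.

(** An eigenvalue of degree [n] is [n] times a root of [char_poly_deg Q n].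
    Conversely, at such a value the diagonal entries of index [l < n] are
    nonzero multiples of the sums of [eventually_nonresonant], with [r = n - l]. *)
Lemma eigenvalue_labelling_scaled :
  eigenvalue_labelling Q alpha (fun n j => n%:R * t n j).
Proof.
have [N1 hN1] := t_eventually_injective.
have [c [V [N2 [c0 V0 hN2]]]] := eventually_nonresonant.
split; last first.
  move=> j; apply/cvgrPdist_lt => /= eps; rewrite ltcE => /andP[/eqP /= ime ree].
  have e2 : 0 < complex.Re eps / 2 by rewrite divr_gt0.
  have [N hN] := t_lim e2; exists N.+1 => //= n /= Nn.
  have n0 : n%:R != 0 :> R[i] by rewrite pnatr_eq0 -lt0n (leq_trans _ Nn).
  rewrite mulrAC mulfV // mul1r nmE ltcE /= ime eqxx /=.
  by apply: le_lt_trans (hN n j (ltnW Nn)) _; lra.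
exists (N1 + N2).+1 => n hn.
have h1 : (N1 <= n)%N by lia.
have h2 : (N2 <= n)%N by lia.
have n0 : (0 < n)%N by apply: leq_trans hn.
have n0' : n%:R != 0 :> R[i] by rewrite pnatr_eq0 -lt0n.
split=> [i j /(mulfI n0') /(hN1 n h1) //|mu]; split=> [[p hp]|[j ->]].
  have := eigenpolynomial_deg_diag hQ hp.
  have -> : mu = n%:R * (mu / n%:R) by rewrite mulrCA mulfV // mulr1.
  rewrite pencil_diagE // => /eqP; rewrite mulf_eq0 expf_eq0 (negbTE n0') andbF /=.
  by move=> /(char_poly_deg_roots (hN1 n h1)) [j ->]; exists j.
have [_ _ t0 _ ht] := hN2 n j h2.
apply: eigenpolynomial_deg_exists => //.
  by rewrite pencil_diagE // (eqP (t_root n j)) mulr0.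
move=> l ln; rewrite -(subKn (ltnW ln)) pencil_diag_lower ?leq_subr //.
have r0 : (0 < n - l)%N by rewrite subn_gt0.
rewrite oppr_eq0 !mulf_neq0 ?expf_neq0 ?invr_neq0 ?mulf_neq0 ?pnatr_eq0 -?lt0n //.
rewrite -nm_gt0; have := ht _ r0; set T := 1 + _; set S := nm _ => /= hS.
have T0 : 0 < T by rewrite ltr_pwDl // mulr_ge0 ?nm_ge0.
rewrite -(pmulr_rgt0 _ T0); apply: lt_le_trans hS.
by rewrite mulr_gt0 // exprn_gt0.
Qed.

(** The majorant is applied for each order of truncation, with [w] built from
    the power sums of the roots.  The bounds that it requires do not depend on
    the degree, on [j] or on the order of truncation. *)
Lemma eigenpolynomial_roots_bounded : exists (rho : R) (N : nat), 0 < rho /\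
  forall (n : nat) (j : 'I_k) (p : {poly R[i]}), (N <= n)%N ->
    eigenpolynomial_deg Q n (n%:R * t n j) p ->
    forall z : R[i], root p z -> nm z <= rho.
Proof.
have [c [V [N [c0 V0 hN]]]] := eventually_nonresonant.
have [k0|k0] := posnP k.
  by exists 1, 0%N; split=> // n j; have := ltn_ord j; rewrite {2}k0.
pose K := \sum_(i < k.+1) \sum_(d < k.+1) V ^+ i * nm (Q i)`_d.
have K0 : 0 <= K.
  by do 2! apply: sumr_ge0 => ? _; rewrite mulr_ge0 ?exprn_ge0 ?nm_ge0.
have [M M1 hM] := riccati_majorant k0 K0 c0.
have M0 : 0 < M by apply: lt_le_trans M1.
exists M, N; split=> // n j p Nn [[p0 hp] sp] z rz.
have [n0 kn t0 tV ht] := hN n j Nn.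
have n0' : n%:R != 0 :> R[i] by rewrite pnatr_eq0 -lt0n.
have nn : nm (n%:R^-1 : R[i]) = n%:R^-1 by rewrite nmV nm_nat.
have [rs hrs] := closed_field_poly_normal p.
have srs : size rs = n.
  have := sp; rewrite hrs size_scale ?lead_coef_eq0 // size_prod_XsubC.
  by case.
have zrs : z \in rs.
  by move: rz; rewrite hrs rootZ ?lead_coef_eq0 // root_prod_XsubC.
apply: (@psum_bound_roots _ rs n%:R) zrs => // r.
(* The power sum of index 0 is the degree. *)
case: r => [|r].
  rewrite expr0 mulr1 /psum; under eq_bigr => ? _ do rewrite expr0.
  by rewrite big_const_seq count_predT iter_addr_0 srs nm_nat.
pose w : {poly R[i]} := n%:R^-1 *: \poly_(s < r.+2) psum rs s.
pose q (i : 'I_k.+1) : {poly R[i]} := (t n j)^-1 ^+ i *: recip i (Q i).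
have n0R : 0 < n%:R :> R by rewrite ltr0n.
suff hw : nm w`_r.+1 <= M ^+ r.+1.
  move: hw; rewrite /w coefZ coef_poly ltnSn nmM nn mulrC ler_pdivrMr //.
  by rewrite mulrC.
apply: (hM n%:R^-1 w q r.+2) => //.
- by rewrite nn invf_le1 // ler1n.
- rewrite coefZ coef_poly /= /psum; under eq_bigr => ? _ do rewrite expr0.
  by rewrite big_const_seq count_predT iter_addr_0 srs mulVf.
- move=> i; apply: leq_trans (size_scale_leq _ _) _.
  by apply: leq_trans (size_poly _ _) _.
- move=> i d; rewrite coefZ coef_poly nmM nmX.
  have hq d' : nm (t n j)^-1 ^+ i * nm (Q i)`_d' <= V ^+ i * nm (Q i)`_d'.
    by rewrite ler_wpM2r ?nm_ge0 // lerXn2r ?nnegrE ?nm_ge0.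
  case: ifP => _; last by rewrite nm0 mulr0.
  apply: le_trans (hq _) _; rewrite /K (bigD1 i) //=.
  have ik : (i - d < k.+1)%N by apply: leq_ltn_trans (leq_subr _ _) (ltn_ord i).
  rewrite (bigD1 (Ordinal ik)) //= -addrA lerDl addr_ge0 //.
    by apply: sumr_ge0 => ? _; rewrite mulr_ge0 ?exprn_ge0 ?nm_ge0.
  by do 2! apply: sumr_ge0 => ? _; rewrite mulr_ge0 ?exprn_ge0 ?nm_ge0.
- move=> s s0; have := ht s s0; set H := \sum_i _; set H' := \sum_i _.
  suff -> : H = H' by [].
  apply: eq_bigr => i _; rewrite coefZ coef_poly /= subn0.
  by rewrite [_ * (Q i)`_i]mulrC.
- move=> s /andP[_ sr].
  have vE i : (t n j)^-1 ^+ i = (n%:R / (n%:R * t n j)) ^+ i.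
    by rewrite invfM mulrA mulfV // mul1r.
  under eq_bigr => i _ do rewrite /q vE.
  by apply: riccati_pencil hp s sr; rewrite ?mulf_neq0.
by rewrite /= ltnSn.
Qed.

End LabelledEigenvalues.

Theorem theorem2 (R : realType) (k : nat) (Q : 'I_k.+1 -> {poly R[i]})
    (alpha : 'I_k -> R[i])
    (hQ : pencil_coefs Q)
    (hgen : general_type Q)
    (halpha : enumerates_char_roots Q alpha) :
  exists lambda : nat -> 'I_k -> R[i],
    eigenvalue_labelling Q alpha lambda /\
    exists (rho : R) (N : nat), 0 < rho /\
      forall (n : nat) (j : 'I_k) (p : {poly R[i]}), (N <= n)%N ->
        eigenpolynomial_deg Q n (lambda n j) p ->
        forall z : R[i], root p z -> `|z| <= rho%:C.
Proof.
have [t [t_root t_lim]] := root_labelling hgen halpha.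
exists (fun n j => n%:R * t n j); split.
  exact: eigenvalue_labelling_scaled.
have [rho [N [rho0 h]]] := eigenpolynomial_roots_bounded hQ hgen halpha t_lim.
exists rho, N; split=> // n j p Nn hp z rz.
by rewrite nmE lecR; apply: h hp z rz.
Qed.
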